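(* Let $G$ be a Lie group modelled on a Fréchet space, with neutral element $e$ and Lie algebra $\mathfrak g=T_eG$, let $M$ be a smooth manifold modelled on a Fréchet space and $\sigma\colon M\times G\to M$ a smooth map which is a right $G$-action. Let $a<b$ be real numbers. If $\gamma\in\mathcal{L}^1([a,b],\mathfrak g)$ has an evolution $\eta\in AC([a,b],G)$, then the differential equation $$\dot y(t)=\gamma(t)_\sharp(y(t))$$ on $M$ (given by the time-dependent vector field $[a,b]\times M\to TM$, $(t,y)\mapsto\gamma(t)_\sharp(y)$) satisfies local existence and local uniqueness of Carathéodory solutions. The mapping $$\mathrm{Fl}\colon[a,b]\times[a,b]\times M\to M,\quad (t,t_0,y_0)\mapsto\sigma(y_0,\eta(t_0)^{-1}\eta(t))$$ is the maximal flow of this differential equation. Moreover, the differential equation admits local flows which are pullbacks of $C^\infty$-maps.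
   Context: **Calculus.** Locally convex spaces are real and Hausdorff. A continuous map $f\colon U\to F$ from an open subset $U$ of a locally convex space $E$ to a locally convex space $F$ is $C^1$ if the directional derivatives $df(x,y)=\frac{d}{dt}|_{t=0}f(x+ty)$ exist for all $(x,y)\in U\times E$ and $df\colon U\times E\to F$ is continuous; it is $C^k$ ($k\ge2$) if it is $C^1$ and $df$ is $C^{k-1}$; smooth ($C^\infty$) if $C^k$ for all $k$. Manifolds (Hausdorff) and Lie groups modelled on locally convex spaces are defined with this notion. **Fundamental vector fields.** For $v\in\mathfrak g$, $v_\sharp\colon M\to TM$ is the vector field $v_\sharp(x):=(T_e\sigma(x,\cdot))(v)$. For $g\in G$ and $v\in TG$, $g.v:=T\lambda_g(v)$ with $\lambda_g(h)=gh$. **Absolute continuity.** $\lambda_1$ is Lebesgue–Borel measure. For a Fréchet space $E$, $\mathcal{L}^1([a,b],E)$ is the set of Borel measurable maps $\gamma\colon[a,b]\to E$ with separable image and $\int_a^b q(\gamma(t))\,dt<\infty$ for each continuous seminorm $q$ on $E$. A map $\eta\colon[a,b]\to E$ is absolutely continuous if there is $\gamma\in\mathcal{L}^1([a,b],E)$ with $\eta(t)=\eta(a)+\int_a^t\gamma(s)\,ds$ (weak integral) for all $t$. A map on an interval $I$ is absolutely continuous if its restrictions to all $[\alpha,\beta]\subseteq I$, $\alpha<\beta$, are. For a $C^1$-manifold $N$ modelled on a Fréchet space, a continuous map $\eta\colon I\to N$ is absolutely continuous if each $t_0\in I$ lies in the interior relative to $I$ of some $[\alpha,\beta]\subseteq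 I$ for which there is a chart $\phi\colon U_\phi\to V_\phi$ with $\eta([\alpha,\beta])\subseteq U_\phi$ and $\phi\circ\eta|_{[\alpha,\beta]}$ absolutely continuous. $AC([a,b],N)$ is the set of absolutely continuous maps $[a,b]\to N$. A continuous $\eta\colon I\to N$ is differentiable at $t_0$ if $\phi\circ\eta$ is so for a chart $\phi$ around $\eta(t_0)$; then $\dot\eta(t_0):=T\phi^{-1}((\phi\circ\eta)(t_0),(\phi\circ\eta)'(t_0))$ (also written $\frac{d\eta}{dt}(t_0)$). **Evolution.** An evolution of $\gamma\in\mathcal{L}^1([a,b],\mathfrak g)$ is a (necessarily unique) $\eta\in AC([a,b],G)$ with $\eta(a)=e$ and $\dot\eta(t)=\eta(t).\gamma(t)$ for almost all $t$. **Carathéodory solutions.** Let $J$ be a non-degenerate interval, $W\subseteq J\times M$, $f\colon W\to TM$ with $f(t,y)\in T_yM$ (in the claim: $J=[a,b]$, $W=J\times M$, $f(t,y)=\gamma(t)_\sharp(y)$). A map $\zeta\colon I\to M$ on a non-degenerate interval is a Carathéodory solution to $\dot y(t)=f(t,y(t))$ if it is absolutely continuous, $(t,\zeta(t))\in W$ for all $t\in I$ and $\dot\zeta(t)=f(t,\zeta(t))$ for almost all $t\in I$; it solves the initial value problem with $y(t_0)=y_0$ if moreover $t_0\in I$ and $\zeta(t_0)=y_0$. *Local existence*: for all $(t_0,y_0)\in W$ there is a Carathéodory solution $I\to M$ to the initial value problem with $y(t_0)=y_0$ such that $I$ is a relatively open subinterval of $J$. *Local uniqueness*: if $\gamma_1\colon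 I_1\to M$, $\gamma_2\colon I_2\to M$ are Carathéodory solutions and $\gamma_1(t_0)=\gamma_2(t_0)$ for some $t_0\in I_1\cap I_2$, then $\gamma_1|_K=\gamma_2|_K$ for some interval $K$ which is an open neighbourhood of $t_0$ in $I_1\cap I_2$. **Maximal flow.** Under local existence and uniqueness, for each $(t_0,y_0)\in W$ there is a Carathéodory solution $\gamma_{t_0,y_0}\colon I_{t_0,y_0}\to M$ to $\dot y(t)=f(t,y(t))$, $y(t_0)=y_0$ which extends every other solution of this initial value problem. The maximal flow is $\mathrm{Fl}\colon\Omega\to M$, $\mathrm{Fl}(t,t_0,y_0):=\gamma_{t_0,y_0}(t)$ on $\Omega:=\bigcup_{(t_0,y_0)\in W}I_{t_0,y_0}\times\{(t_0,y_0)\}$. **Local flows which are pullbacks of $C^k$-maps** ($k\in\mathbb N\cup\{\infty\}$, $W$ open in $J\times M$): for all $(\bar t,\bar y)\in W$ there exist a relatively open interval $I\subseteq J$ with $\bar t\in I$, an open neighbourhood $V$ of $\bar y$ in $M$ with $I\times V\subseteq W$ and a function $\Phi\colon I\times I\times V\to M$, $\Phi_{t,t_0}(y_0):=\Phi(t,t_0,y_0)$, such that: (a) for all $(t_0,y_0)\in I\times V$, the map $I\to M$, $t\mapsto\Phi_{t,t_0}(y_0)$ is a Carathéodory solution to $\dot y(t)=f(t,y(t))$, $y(t_0)=y_0$; (b) there is an open $\bar y$-neighbourhood $Y\subseteq V$ such that $\Phi_{t_1,t_0}(Y)\subseteq V$ for all $t_0,t_1\in I$ and $\Phi_{t_2,t_1}(\Phi_{t_1,t_0}(y_0))=\Phi_{t_2,t_0}(y_0)$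 for all $t_0,t_1,t_2\in I$, $y_0\in Y$; (c) there exist $C^k$-manifolds $N_1,N_2$ modelled on Fréchet spaces, absolutely continuous maps $\zeta_j\colon I\to N_j$ for $j\in\{1,2\}$ and a $C^k$-map $\Psi\colon N_1\times N_2\times V\to M$ with $\Phi(t,t_0,y_0)=\Psi(\zeta_1(t),\zeta_2(t_0),y_0)$ for all $(t,t_0,y_0)$; moreover there is a Borel set $I_0\subseteq I$ with $\lambda_1(I\setminus I_0)=0$ such that $\frac{d}{dt}\Phi_{t,t_0}(y_0)$ exists and equals $f(t,\Phi_{t,t_0}(y_0))$ for all $y_0\in V$, $t_0\in I$, $t\in I_0$. *)

(* Defs.v *)
From HB Require Import structures.
From mathcomp Require Import all_boot all_order all_algebra.
From mathcomp Require Import all_classical all_reals all_analysis.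

Set Implicit Arguments.
Unset Strict Implicit.
Unset Printing Implicit Defensive.

Import Order.TTheory GRing.Theory Num.Theory.
Import numFieldNormedType.Exports.

Local Open Scope classical_set_scope.
Local Open Scope ring_scope.

(* Functions on a subset U of a type T are represented by functions on T whose
   values outside U are irrelevant. *)

Definition metrizable (R : realType) (T : topologicalType) : Prop :=
  exists d : T -> T -> R,
    [/\ forall x y, d x y = 0 <-> x = y,
        forall x y, d x y = d y x,
        forall x y z, d x z <= d x y + d y z &
        forall x (A : set T),
          nbhs x A <-> exists2 r, 0 < r & forall y, d x y < r -> A y].

(* Completeness with respect to the translation-invariant uniformity.  The
   library's [cauchy] is not used: the axioms of [tvsType] do not relate the
   entourages of the carrier to its group structure. *)
Definition tvs_complete (R : realType) (E : tvsType R) : Prop :=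
  forall F : set_system E, ProperFilter F ->
    (fun p : E * E => p.1 - p.2) @ filter_prod F F --> (0 : E) ->
    exists x : E, F --> x.

Definition frechet (R : realType) (E : tvsType R) : Prop :=
  metrizable R E /\ tvs_complete E.

Variant smoothness := Cfin of nat | Cinfty.

Section Calculus.
Context {R : realType}.

Definition diff_quot (E F : tvsType R) (f : E -> F) (x y : E) (h : R) : F :=
  h^-1 *: (f (x + h *: y) - f x).

Definition has_dir_deriv (E F : tvsType R) (f : E -> F) (x y : E) : Prop :=
  exists l : F, diff_quot f x y @ (0 : R)^' --> l.

Definition dir_deriv (E F : tvsType R) (f : E -> F) (p : E * E) : F :=
  xget (0 : F) [set l | diff_quot f p.1 p.2 @ (0 : R)^' --> l].

(* U is meant to be open.  For n = 0, [Cn] is continuity. *)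
Fixpoint Cn (n : nat) (E F : tvsType R) (U : set E) (f : E -> F) : Prop :=
  match n with
  | 0 => forall x, U x -> {for x, continuous f}
  | m.+1 => [/\ forall x, U x -> {for x, continuous f},
               forall x y, U x -> has_dir_deriv f x y &
               Cn m (U `*` [set: E]) (dir_deriv f)]
  end.

Definition Ck (k : smoothness) (E F : tvsType R) (U : set E) (f : E -> F) :=
  match k with
  | Cfin n => Cn n U f
  | Cinfty => forall n, Cn n U f
  end.

End Calculus.

Section Charts.
Context {R : realType}.

Record chart (E : tvsType R) (M : topologicalType) := Chart {
  chart_dom : set M;
  chart_map :> M -> E;
  chart_inv : E -> M;
  chart_dom_open : open chart_dom;
  chart_cod_open : open (chart_map @` chart_dom);
  chart_mapK : forall x, chart_dom x -> chart_inv (chart_map x) = x;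
  chart_map_cont : forall x, chart_dom x -> {for x, continuous chart_map};
  chart_inv_cont : forall y, (chart_map @` chart_dom) y ->
    {for y, continuous chart_inv}
}.

Definition compatible (k : smoothness) (E : tvsType R) (M : topologicalType)
    (c d : chart E M) : Prop :=
  Ck k (c @` (chart_dom c `&` chart_dom d)) (d \o chart_inv c) /\
  Ck k (d @` (chart_dom c `&` chart_dom d)) (c \o chart_inv d).

(* A C^k-manifold structure modelled on E: a maximal C^k-atlas.  The choice,
   for each point, of a chart around it is only used to coordinatise the
   tangent spaces. *)
Record manifold (k : smoothness) (E : tvsType R) (M : topologicalType) :=
  Manifold {
    atlas :> set (chart E M);
    chart_at : M -> chart E M;
    chart_at_atlas : forall x, atlas (chart_at x);
    chart_at_dom : forall x, chart_dom (chart_at x) x;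
    atlas_compatible : forall c d, atlas c -> atlas d -> compatible k c d;
    atlas_maximal : forall c,
      (forall d, atlas d -> compatible k c d) -> atlas c;
    manifold_hausdorff : hausdorff_space M;
    model_hausdorff : hausdorff_space E
  }.

Lemma openX (T U : topologicalType) (A : set T) (B : set U) :
  open A -> open B -> open (A `*` B).
Proof.
rewrite !openE => oA oB [x y] [/= /oA Ax /oB By].
by exists (A, B).
Qed.

Section ProductChart.
Variables (E F : tvsType R) (M N : topologicalType).
Variables (c : chart E M) (d : chart F N).

Let dom : set (M * N) := chart_dom c `*` chart_dom d.
Let map (p : M * N) : E * F := (c p.1, d p.2).
Let inv (q : E * F) : M * N := (chart_inv c q.1, chart_inv d q.2).

Let image_map : map @` dom = (c @` chart_dom c) `*` (d @` chart_dom d).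
Proof.
apply/seteqP; split=> [_ [[x y] [/= cx dy]] <-|[u v] [/= [x cx <-] [y dy <-]]].
  by split; [exists x|exists y].
by exists (x, y).
Qed.

Let cod_open : open (map @` dom).
Proof. by rewrite image_map; apply: openX; exact: chart_cod_open. Qed.

Let mapK p : dom p -> inv (map p) = p.
Proof. by case: p => x y [/= cx dy]; rewrite /inv /= !chart_mapK. Qed.

Let map_cont p : dom p -> {for p, continuous map}.
Proof.
case: p => x y [/= cx dy]; apply: cvg_pair => /=.
- apply: (cvg_comp (@fst M N) c (G := nbhs x)); first exact: cvg_fst.
  exact: chart_map_cont.
- apply: (cvg_comp (@snd M N) d (G := nbhs y)); first exact: cvg_snd.
  exact: chart_map_cont.
Qed.

Let inv_cont q : (map @` dom) q -> {for q, continuous inv}.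
Proof.
rewrite image_map; case: q => u v [/= cu dv]; apply: cvg_pair => /=.
- apply: (cvg_comp (@fst E F) (chart_inv c) (G := nbhs u)); first exact: cvg_fst.
  exact: chart_inv_cont.
- apply: (cvg_comp (@snd E F) (chart_inv d) (G := nbhs v)); first exact: cvg_snd.
  exact: chart_inv_cont.
Qed.

Definition prod_chart : chart (E * F)%type (M * N)%type :=
  Chart (openX (chart_dom_open c) (chart_dom_open d)) cod_open mapK map_cont
    inv_cont.

End ProductChart.

(* A (non-maximal) atlas of the product manifold. *)
Definition prod_atlas (E F : tvsType R) (M N : topologicalType)
    (A : set (chart E M)) (B : set (chart F N)) :
    set (chart (E * F)%type (M * N)%type) :=
  [set prod_chart c d | c in A & d in B].

(* f is C^k on the open submanifold O. *)
Definition Ck_map (k : smoothness) (E F : tvsType R) (M N : topologicalType)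
    (A : set (chart E M)) (B : set (chart F N)) (O : set M) (f : M -> N) :=
  (forall x, O x -> {for x, continuous f}) /\
  forall c d, A c -> B d ->
    Ck k (c @` (chart_dom c `&` O `&` f @^-1` chart_dom d))
      (d \o f \o chart_inv c).

(* T_x M, with its topological vector space structure: a tangent vector at x
   is represented by its coordinates in the chart [chart_at S x]. *)
Definition tangent (k : smoothness) (E : tvsType R) (M : topologicalType)
    (S : manifold k E M) (x : M) : tvsType R := E.

Definition tangent_map (k l : smoothness) (E F : tvsType R)
    (M N : topologicalType) (S : manifold k E M) (T : manifold l F N)
    (f : M -> N) (x : M) (v : tangent S x) : tangent T (f x) :=
  dir_deriv (chart_at T (f x) \o f \o chart_inv (chart_at S x))
    (chart_at S x x, v).

End Charts.

Section Curves.
Context {R : realType}.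
Local Notation mu := (@lebesgue_measure R).

Definition continuous_seminorm (E : tvsType R) (q : E -> R) : Prop :=
  [/\ forall x y, q (x + y) <= q x + q y,
      forall (r : R) x, q (r *: x) = `|r| * q x & continuous q].

Definition L1 (E : tvsType R) (a b : R) (g : R -> E) : Prop :=
  [/\ forall B : set E, <<s @open E >> B ->
        measurable (`[a, b]%classic `&` g @^-1` B),
      exists D : set E, [/\ countable D, D `<=` g @` `[a, b]%classic &
        g @` `[a, b]%classic `<=` closure D] &
      forall q : E -> R, continuous_seminorm q ->
        (\int[mu]_(t in `[a, b]%classic) (q (g t))%:E < +oo)%E].

Definition weak_integral (E : tvsType R) (a b : R) (g : R -> E) (z : E) : Prop :=
  forall l : {linear E -> R^o}, continuous l ->
    l z = \int[mu]_(t in `[a, b]%classic) (l (g t)).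

Definition AC_segment (E : tvsType R) (a b : R) (eta : R -> E) : Prop :=
  exists2 g : R -> E, L1 a b g &
    forall t, a <= t <= b -> weak_integral a t g (eta t - eta a).

Definition nondegenerate_interval (I : set R) : Prop :=
  is_interval I /\ exists x y, [/\ I x, I y & x < y].

Definition relatively_open (J I : set R) : Prop :=
  exists2 O : set R, open O & I = J `&` O.

Definition AC (E : tvsType R) (N : topologicalType) (A : set (chart E N))
    (I : set R) (eta : R -> N) : Prop :=
  {within I, continuous eta} /\
  forall t0, I t0 -> exists al be : R,
    [/\ al < be, `[al, be]%classic `<=` I,
        within I (nbhs t0) `[al, be]%classic &
        exists c : chart E N,
          [/\ A c, eta @` `[al, be]%classic `<=` chart_dom c &
              AC_segment al be (c \o eta)]].

(* Derivative at t of a function defined on the interval I (one-sided at an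
   endpoint of I). *)
Definition has_deriv (E : tvsType R) (I : set R) (g : R -> E) (t : R) (w : E) :=
  (fun h : R => h^-1 *: (g (t + h) - g t))
    @ within [set h | I (t + h)] (0 : R)^' --> w.

(* The velocity of eta at t exists and equals v. *)
Definition has_velocity (k : smoothness) (E : tvsType R) (N : topologicalType)
    (S : manifold k E N) (I : set R) (eta : R -> N) (t : R)
    (v : tangent S (eta t)) : Prop :=
  exists (c : chart E N) (w : E),
    [/\ atlas S c, chart_dom c (eta t), has_deriv I (c \o eta) t w &
        v = dir_deriv (chart_at S (eta t) \o chart_inv c) (c (eta t), w)].

End Curves.

Section Caratheodory.
Context {R : realType} {l : smoothness} {E : tvsType R} {M : topologicalType}.
Variables (S : manifold l E M) (J : set R) (W : set (R * M)).
Variable f : R -> forall y : M, tangent S y.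

Definition solution (I : set R) (zeta : R -> M) : Prop :=
  [/\ nondegenerate_interval I, AC S I zeta, forall t, I t -> W (t, zeta t) &
      {ae (@lebesgue_measure R), forall t, I t ->
        has_velocity I (f t (zeta t))}].

Definition ivp_solution (t0 : R) (y0 : M) (I : set R) (zeta : R -> M) : Prop :=
  [/\ solution I zeta, I t0 & zeta t0 = y0].

Definition local_existence : Prop :=
  forall t0 y0, W (t0, y0) ->
    exists (I : set R) (zeta : R -> M),
      ivp_solution t0 y0 I zeta /\ relatively_open J I.

Definition local_uniqueness : Prop :=
  forall (I1 I2 : set R) (z1 z2 : R -> M), solution I1 z1 -> solution I2 z2 ->
    forall t0, I1 t0 -> I2 t0 -> z1 t0 = z2 t0 ->
    exists K : set R,
      [/\ is_interval K, K t0, relatively_open (I1 `&` I2) K &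
          forall t, K t -> z1 t = z2 t].

(* Fl : Om -> M is the maximal flow; points of Om are triples ((t, t0), y0). *)
Definition maximal_flow (Om : set (R * R * M)) (Fl : R * R * M -> M) : Prop :=
  (forall t t0 y0, Om (t, t0, y0) -> W (t0, y0)) /\
  forall t0 y0, W (t0, y0) ->
    ivp_solution t0 y0 [set t | Om (t, t0, y0)] (fun t => Fl (t, t0, y0)) /\
    forall (I : set R) (zeta : R -> M), ivp_solution t0 y0 I zeta ->
      forall t, I t -> Om (t, t0, y0) /\ Fl (t, t0, y0) = zeta t.

(* To be used with k = Cinfty or k = Cfin n for n >= 1. *)
Definition local_flows_pullback (k : smoothness) : Prop :=
  forall tbar ybar, W (tbar, ybar) ->
  exists (I : set R) (V : set M) (Phi : R -> R -> M -> M),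
    [/\ is_interval I, relatively_open J I & I tbar] /\
    [/\ open V, V ybar & I `*` V `<=` W] /\
    (forall t0 y0, I t0 -> V y0 ->
      ivp_solution t0 y0 I (fun t => Phi t t0 y0)) /\
    (exists Y : set M, [/\ open Y, Y ybar, Y `<=` V,
      forall t0 t1 y0, I t0 -> I t1 -> Y y0 -> V (Phi t1 t0 y0) &
      forall t0 t1 t2 y0, I t0 -> I t1 -> I t2 -> Y y0 ->
        Phi t2 t1 (Phi t1 t0 y0) = Phi t2 t0 y0]) /\
    (exists (E1 E2 : tvsType R) (N1 N2 : topologicalType)
        (S1 : manifold k E1 N1) (S2 : manifold k E2 N2)
        (zeta1 : R -> N1) (zeta2 : R -> N2) (Psi : N1 * N2 * M -> M),
      [/\ frechet E1, frechet E2, AC S1 I zeta1 & AC S2 I zeta2] /\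
      Ck_map k (prod_atlas (prod_atlas S1 S2) S) S ([set: N1 * N2] `*` V) Psi /\
      forall t t0 y0, I t -> I t0 -> V y0 ->
        Phi t t0 y0 = Psi (zeta1 t, zeta2 t0, y0)) /\
    (exists I0 : set R,
      [/\ measurable I0, I0 `<=` I, @lebesgue_measure R (I `\` I0) = 0%E &
        forall y0 t0 t, V y0 -> I t0 -> I0 t ->
          has_velocity (eta := fun t => Phi t t0 y0) I (f t (Phi t t0 y0))]).

End Caratheodory.

(* A type with a topology and a group law; continuity of the group operations
   is part of [lie_group]. *)
#[short(type="groupTopologicalType")]
HB.structure Definition GroupTopological := {G of Topological G & Group G}.

Section LieGroups.
Context {R : realType}.
Local Open Scope group_scope.

Definition lie_group (E : tvsType R) (G : groupTopologicalType)
    (S : manifold Cinfty E G) : Prop :=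
  Ck_map Cinfty (prod_atlas S S) S [set: G * G] (fun p => p.1 * p.2) /\
  Ck_map Cinfty S S [set: G] (fun g : G => g^-1).

Definition right_action (G : groupTopologicalType) (M : topologicalType)
    (sigma : M * G -> M) : Prop :=
  (forall x, sigma (x, 1) = x) /\
  forall x g h, sigma (sigma (x, g), h) = sigma (x, g * h).

(* g.v = T(lambda_g)(v) for v in T_e G, an element of T_{g e} G = T_g G. *)
Definition left_translate (E : tvsType R) (G : groupTopologicalType)
    (S : manifold Cinfty E G) (g : G) (v : tangent S 1) : tangent S g :=
  tangent_map S (fun h : G => g * h) v.

(* The fundamental vector field v_sharp; sigma(x, .) maps e to x, so the value
   at x lies in T_{sigma(x, e)} M = T_x M. *)
Definition fundamental (E F : tvsType R) (G : groupTopologicalType)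
    (M : topologicalType) (S : manifold Cinfty E G)
    (T : manifold Cinfty F M) (sigma : M * G -> M) (v : tangent S 1)
    (x : M) : tangent T x :=
  tangent_map T (fun g : G => sigma (x, g)) v.

Definition evolution (E : tvsType R) (G : groupTopologicalType)
    (S : manifold Cinfty E G) (a b : R) (gamma : R -> tangent S 1)
    (eta : R -> G) : Prop :=
  [/\ AC S `[a, b]%classic eta, eta a = 1 &
      {ae (@lebesgue_measure R), forall t, `[a, b]%classic t ->
        has_velocity `[a, b]%classic (left_translate (eta t) (gamma t))}].

End LieGroups.

(* Main.v *)
Require Import Defs.
From HB Require Import structures.
From mathcomp Require Import all_boot all_order all_algebra.
From mathcomp Require Import all_classical all_reals all_analysis.
From mathcomp Require Import measurable_realfun ring lra.

Set Implicit Arguments.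
Unset Strict Implicit.
Unset Printing Implicit Defensive.

Import Order.TTheory GRing.Theory Num.Theory.
Import numFieldNormedType.Exports.

Local Open Scope classical_set_scope.
Local Open Scope ring_scope.

(** The curve [t |-> sigma (y0, (eta t0)^-1 * eta t)] is the composite of the
    absolutely continuous curve [eta] with a smooth map [k : G -> M], so it is
    absolutely continuous by a chain rule.  Where [eta' = eta.gamma], its
    velocity at [t] is the differential of [h |-> k (eta t * h)] at [1] applied
    to [gamma t]; since [k (eta t * h) = sigma (y, h)] for the current point
    [y], this is the fundamental field of [gamma t] at [y].  Conversely, if
    [zeta] is any solution, then [w t = sigma (zeta t, (eta t)^-1)] is absolutely
    continuous, and its velocity is almost everywhere the differential at [1]
    of the constant map [h |-> sigma (sigma (zeta t, h), (eta t * h)^-1)].  So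
    [w] has velocity zero almost everywhere, hence is constant, and
    [zeta t = sigma (zeta s, (eta s)^-1 * eta t)] for all [s] and [t]
    ([solution_action_flow]).  This yields uniqueness and maximality, while the
    flow is the pullback of the smooth map [(g, h, y) |-> sigma (y, h^-1 * g)]
    along the pair [(eta, eta)].

    The work lies in two facts about absolutely continuous curves in locally
    convex spaces.

    Chain rule ([primitive_comp]).  Absolute continuity is defined by weak
    integrals, so one tests [f \o eta] against a continuous functional [l].  On
    a short segment [[s, u]] the increment of [l \o f \o eta] is close to
    [l (df (eta s, -))] applied to [eta u - eta s]; this is a continuous linear
    functional, which commutes with the weak integral.  The mean value theorem
    and a Lipschitz estimate for the differential of a C^2-map ([C2_bound])
    control the error by an arbitrarily small multiple of the integral of a
    seminorm of the derivative of [eta].  All these estimates concatenate, and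
    [segment_principle] sums them up.

    Constancy ([primitive_deriv0]).  If the derivative vanishes almost
    everywhere, then for each functional [l] the integrand [l \o g] is zero
    almost everywhere by the Lebesgue differentiation theorem for real
    functions, so [l \o w] is constant, and functionals separate points.

    Both use the Hahn-Banach theorem, in the form that every continuous seminorm
    is attained by a continuous functional below it ([seminorm_functional]), and
    the fact that local convexity provides enough seminorms ([gauge_seminorm]).
    Measurability of pairs of curves ([borel_separable_pair]) rests on
    metrizability and on the separable ranges built into the definition of L^1.
    Smooth maps compose because [d (f \o g)] is again a composite
    ([Cn_comp]). *)

(** * Seminorms and continuous functionals *)

Lemma cvg_near {T : Type} {U : topologicalType} (F : set_system T) (f : T -> U)
    (x : U) (A : set U) :
  f @ F --> x -> nbhs x A -> \forall t \near F, A (f t).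
Proof. by move=> fx /fx. Qed.

Section TvsLimits.
Context {R : realType} {E : tvsType R} {T : Type} (F : set_system T).
Context {FF : Filter F}.

Lemma tvs_cvgD (f g : T -> E) (x y : E) :
  f @ F --> x -> g @ F --> y -> (fun t => f t + g t) @ F --> x + y.
Proof.
move=> fx gy; apply: (cvg_comp (fun t => (f t, g t)) (fun p : E * E => p.1 + p.2)
  (G := nbhs (x, y))); first exact: (cvg_pair (G := nbhs x) (H := nbhs y)).
exact: (@add_continuous E (x, y)).
Qed.

Lemma tvs_cvgZ (r : T -> R) (f : T -> E) (s : R) (x : E) :
  r @ F --> s -> f @ F --> x -> (fun t => r t *: f t) @ F --> s *: x.
Proof.
move=> rs fx; apply: (cvg_comp (fun t => (r t, f t))
  (fun p : R^o * E => p.1 *: p.2) (G := nbhs ((s : R^o), x))).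
  exact: (cvg_pair (G := nbhs (s : R^o)) (H := nbhs x)).
exact: (@scale_continuous R E ((s : R^o), x)).
Qed.

Lemma tvs_cvgB (f g : T -> E) (x y : E) :
  f @ F --> x -> g @ F --> y -> (fun t => f t - g t) @ F --> x - y.
Proof.
move=> fx gy; apply: (cvg_comp (fun t => (f t, g t)) (fun p : E * E => p.1 - p.2)
  (G := nbhs (x, y))); first exact: (cvg_pair (G := nbhs x) (H := nbhs y)).
exact: (@sub_continuous E (x, y)).
Qed.

End TvsLimits.

Lemma cvg_line {R : realType} (E : tvsType R) (x y : E) :
  (fun h : R => x + h *: y) @ (0 : R)^' --> x.
Proof.
rewrite -[X in _ --> X]addr0 -(scale0r y); apply: tvs_cvgD.
  exact: cvg_cst.
by apply: tvs_cvgZ; [exact: (@nbhs_dnbhs R 0)|exact: cvg_cst].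
Qed.

Lemma cvg_shift {R : realType} (t : R) : (fun h : R => t + h) @ (0 : R)^' --> t.
Proof.
rewrite -[X in _ --> X]addr0.
by apply: (@cvgD _ R^o); [exact: cvg_cst|exact: (@nbhs_dnbhs R 0)].
Qed.

Section Seminorms.
Context {R : realType} {E : tvsType R} (q : E -> R).
Hypothesis hq : continuous_seminorm q.

Lemma seminormD x y : q (x + y) <= q x + q y.
Proof. by case: hq. Qed.

Lemma seminormZ (r : R) x : q (r *: x) = `|r| * q x.
Proof. by case: hq. Qed.

Lemma seminorm_continuous : continuous q.
Proof. by case: hq. Qed.

Lemma seminorm0 : q 0 = 0.
Proof. by rewrite -(scale0r (0 : E)) seminormZ normr0 mul0r. Qed.

Lemma seminormN x : q (- x) = q x.
Proof. by rewrite -scaleN1r seminormZ normrN1 mul1r. Qed.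

Lemma seminormBC x y : q (x - y) = q (y - x).
Proof. by rewrite -seminormN opprB. Qed.

Lemma seminorm_ge0 x : 0 <= q x.
Proof.
have := seminormD x (- x); rewrite subrr seminorm0 seminormN; lra.
Qed.

Lemma seminorm_ball (x : E) (e : R) : 0 < e -> \forall y \near x, q (y - x) < e.
Proof.
move=> e0; have : (fun y => q (y - x)) @ x --> q (x - x).
  apply: (cvg_comp (fun y => y - x) q (G := nbhs (x - x))).
    by apply: tvs_cvgB; [exact: cvg_id|exact: cvg_cst].
  exact: seminorm_continuous.
by rewrite subrr seminorm0 => /cvgr_lt; apply.
Qed.

End Seminorms.

Section Gauge.
Context {R : realType} {E : tvsType R}.

Let absorbs (C : set E) (x : E) : set R := [set t | 0 < t /\ C (t^-1 *: x)].

Let gauge (C : set E) (x : E) : R := inf (absorbs C x).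

(** The gauge (Minkowski functional) of [C]; it is continuous because it is at
    most [e] on [e *: C]. *)
Lemma gauge_seminorm (C : set E) :
  nbhs (0 : E) C -> (forall x, C x -> C (- x)) ->
  (forall x y (t : R), 0 <= t <= 1 -> C x -> C y -> C (t *: x + (1 - t) *: y)) ->
  exists2 q : E -> R, continuous_seminorm q & forall x, q x < 1 -> C x.
Proof.
move=> C0 Cs Cc.
have C00 : C 0 by exact: nbhs_singleton.
have shrink (t : R) x : 0 <= t <= 1 -> C x -> C (t *: x).
  by move=> t01 Cx; have := Cc _ _ _ t01 Cx C00; rewrite scaler0 addr0.
have ne x : absorbs C x !=set0.
  have : (fun t : R => t *: x) @ 0^'+ --> (0 : R) *: x.
    by apply: tvs_cvgZ; [exact/cvg_at_right_filter/cvg_id|exact: cvg_cst].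
  rewrite scale0r => /cvg_near/(_ C0) h.
  have /filter_ex[t [Ct t0]] : (0 : R)^'+ [set t : R | C (t *: x) /\ 0 < t].
    by apply: filterI; [exact: h|exact: nbhs_right_gt].
  by exists t^-1; split; [rewrite invr_gt0|rewrite invrK].
have lb x : has_lbound (absorbs C x) by exists 0 => t [/ltW].
have gauge_le x t : absorbs C x t -> gauge C x <= t.
  by move=> xt; apply: ge_inf.
have gauge_lt x t : gauge C x < t -> absorbs C x t.
  move=> /(inf_lt (ne x))[s [s0 Cs0] st]; have t0 := lt_trans s0 st; split=> //.
  have -> : t^-1 *: x = (s / t) *: (s^-1 *: x).
    by rewrite scalerA mulrAC mulfV ?mul1r ?gt_eqF.
  apply: shrink => //; rewrite divr_ge0 ?(ltW s0) ?(ltW t0)//=.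
  by rewrite ler_pdivrMr// mul1r ltW.
have gauge_ge0 x : 0 <= gauge C x by apply: lb_le_inf => // t [/ltW].
have leZ (r : R) x : r != 0 -> gauge C (r *: x) <= `|r| * gauge C x.
  move=> r0; have rp : 0 < `|r| by rewrite normr_gt0.
  apply/unstable.ler_gtP => t; rewrite -ltr_pdivlMl// mulrC => /gauge_lt[t0 Ct].
  have t'0 : 0 < t by move: t0; rewrite pmulr_lgt0// invr_gt0.
  apply: gauge_le; split => //; move: Ct; rewrite invfM invrK scalerA.
  have [r1|r1] := leP 0 r; first by rewrite ger0_norm.
  rewrite ltr0_norm// => /Cs; congr C; rewrite -scaleNr; congr (_ *: _); ring.
exists (gauge C); last first.
  by move=> x /gauge_lt[_]; rewrite invr1 scale1r.
have gZ (r : R) x : gauge C (r *: x) = `|r| * gauge C x.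
  have [->|r0] := eqVneq r 0.
    rewrite scale0r normr0 mul0r; apply/le_anti; rewrite gauge_ge0 andbT.
    by apply/unstable.ler_gtP => t t0; apply: gauge_le; split=> //; rewrite scaler0.
  apply/le_anti; rewrite leZ//= -ler_pdivlMl ?normr_gt0// -normfV.
  have := leZ r^-1 (r *: x); rewrite scalerA mulVf// scale1r.
  by apply; rewrite invr_eq0.
have gD x y : gauge C (x + y) <= gauge C x + gauge C y.
  apply/unstable.ler_gtP => t; set u := gauge C x; set v := gauge C y => uvt.
  pose s := u + (t - u - v) / 2.
  have [s0 Cx] : absorbs C x s by apply: gauge_lt; rewrite /s -/u; lra.
  have [s1 Cy] : absorbs C y (t - s) by apply: gauge_lt; rewrite /s -/v; lra.
  have t0 : 0 < t by lra.
  apply: gauge_le; split=> //.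
  have -> : t^-1 *: (x + y) =
      (s / t) *: (s^-1 *: x) + (1 - s / t) *: ((t - s)^-1 *: y).
    rewrite !scalerA scalerDr; congr (_ *: _ + _ *: _); field;
      by rewrite ?gt_eqF.
  apply: Cc => //; rewrite divr_ge0 ?(ltW s0) ?(ltW t0)//=.
  by rewrite ler_pdivrMr// mul1r; lra.
split=> // x; apply/cvgrPdist_le => e e0.
have : (fun y => e^-1 *: (y - x)) @ x --> e^-1 *: (x - x).
  apply: tvs_cvgZ; first exact: cvg_cst.
  by apply: tvs_cvgB; [exact: cvg_id|exact: cvg_cst].
rewrite subrr scaler0 => /cvg_near/(_ C0).
apply: filterS => y Cy.
have ge : gauge C (y - x) <= e by exact: gauge_le.
have ge' : gauge C (x - y) <= e by rewrite -opprB -scaleN1r gZ normrN1 mul1r.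
have := gD (x - y) y; have := gD (y - x) x; rewrite !subrK ler_norml; lra.
Qed.

(** Intersecting a convex neighbourhood with its negative makes its gauge a
    seminorm; this is the only use of local convexity. *)
Lemma nbhs_seminorm (x : E) (U : set E) : nbhs x U ->
  exists2 q : E -> R, continuous_seminorm q & forall y, q (y - x) < 1 -> U y.
Proof.
move=> Ux; have : (fun y : E => x + y) @ (0 : E) --> x + 0.
  by apply: tvs_cvgD; [exact: cvg_cst|exact: cvg_id].
rewrite addr0 => /(_ _ Ux) U0.
have [B Bconv [Bo Bb]] := @locally_convex R E.
have [b [Bb' b0] bU] := Bb _ _ U0.
have bconv y z (t : R) : 0 <= t <= 1 -> b y -> b z -> b (t *: y + (1 - t) *: z).
  move=> t01 byy bz; have /andP[t0 t1] := t01.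
  have := Bconv b (mem_set Bb') y z (Itv01 t0 t1) (mem_set byy) (mem_set bz).
  by rewrite inE.
have bnbhs : nbhs (0 : E) b by apply: open_nbhs_nbhs; split=> //; exact: Bo.
pose C := b `&` [set y | b (- y)].
have [] := @gauge_seminorm C.
- apply: filterI => //; have : (fun y : E => 0 - y) @ (0 : E) --> (0 : E) - 0.
    by apply: tvs_cvgB; [exact: cvg_cst|exact: cvg_id].
  rewrite subr0 => /cvg_near/(_ bnbhs).
  by apply: filterS => y; rewrite /= sub0r.
- by move=> y [? ?]; split; rewrite /= ?opprK.
- move=> y z t t01 [yb yb'] [zb zb']; split => /=; first exact: bconv.
  by rewrite opprD -!scalerN; exact: bconv.
move=> q hq qC; exists q => // y /qC[yb _].
by have := bU _ yb; rewrite /= subrKC.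
Qed.

Lemma cvg_seminorm {T : Type} (F : set_system T) {FF : Filter F} (f : T -> E)
    (x : E) :
  (forall q, continuous_seminorm q -> forall e, 0 < e ->
     \forall t \near F, q (f t - x) < e) -> f @ F --> x.
Proof.
move=> h U /nbhs_seminorm[q hq qU]; apply: filterS (h q hq 1 ltr01) => t.
exact: qU.
Qed.

Lemma seminorm_separates (x y : E) : hausdorff_space E ->
  (forall q, continuous_seminorm q -> q (x - y) = 0) -> x = y.
Proof.
move=> hE h; apply: hE => A B Ax By.
have [q hq qA] := nbhs_seminorm Ax.
exists y; split; last exact: nbhs_singleton.
by apply: qA; rewrite seminormBC// h.
Qed.

End Gauge.
Section HahnBanach.
Context {R : realType} {V : lmodType R} (p : V -> R).
Hypothesis pD : forall x y, p (x + y) <= p x + p y.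
Hypothesis pZ : forall (r : R) x, p (r *: x) = `|r| * p x.

(* The graph of a linear functional dominated by [p] on a subspace of [V]:
   [f (0, r)] forces [r = 0], since [r] and [- r] are at most [p 0]. *)
Let dominated (f : set (V * R)) : Prop :=
  [/\ f (0, 0), forall x y (a : R), f x -> f y -> f (x + (a *: y.1, a * y.2)) &
      forall x, f x -> x.2 <= p x.1].

Let p0 : p 0 = 0.
Proof. by rewrite -(scale0r (0 : V)) pZ normr0 mul0r. Qed.

Let pN x : p (- x) = p x.
Proof. by rewrite -scaleN1r pZ normrN1 mul1r. Qed.

Let p_ge0 x : 0 <= p x.
Proof. have := pD x (- x); rewrite subrr p0 pN; lra. Qed.

Let dominated_fun f x r s : dominated f -> f (x, r) -> f (x, s) -> r = s.
Proof.
move=> [_ fl fb].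
have le r' s' : f (x, r') -> f (x, s') -> r' <= s'.
  move=> fr fs; have := fb _ (fl _ _ (-1) fr fs).
  by rewrite /= scaleN1r subrr p0; lra.
by move=> fr fs; apply/le_anti; rewrite !le.
Qed.

(* One more dimension: the value [c] at [v] must satisfy
   [r - p (w - v) <= c <= p (w + v) - r] for all [(w, r)] in the graph. *)
Let dominated_extend f v : dominated f ->
  exists2 g, dominated g & f `<=` g /\ exists c, g (v, c).
Proof.
move=> [f0 fl fb].
have fZ (a : R) x : f x -> f (a *: x.1, a * x.2).
  by move=> fx; have := fl _ _ a f0 fx; rewrite add0r.
pose A := [set s | exists2 x, f x & s = x.2 - p (x.1 - v)].
have ub x : f x -> ubound A (p (x.1 + v) - x.2).
  move=> fx _ [y fy ->]; have := fb _ (fl _ _ 1 fx fy) => /=.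
  rewrite scale1r mul1r => h; have := pD (x.1 + v) (y.1 - v).
  by rewrite addrACA subrr addr0; lra.
have A0 : A !=set0 by exists (0 - p (0 - v)); exists (0, 0).
pose c := sup A.
have c_le x : f x -> c <= p (x.1 + v) - x.2.
  by move=> fx; apply: ge_sup => //; exact: ub.
have le_c x : f x -> x.2 - p (x.1 - v) <= c.
  move=> fx; apply: ub_le_sup; last by exists x.
  by exists (p (0 + v) - 0); exact: (ub (0, 0)).
exists [set z | exists x, exists2 t : R, f x & z = x + (t *: v, t * c)].
  split=> /=.
  - by exists (0, 0), 0 => //; rewrite scale0r mul0r addr0.
  - move=> _ _ a [x [s fx ->]] [y [t fy ->]].
    exists (x + (a *: y.1, a * y.2)), (s + a * t); first exact: fl.
    congr (_, _) => /=; first by rewrite scalerDr scalerDl scalerA addrACA.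
    by rewrite mulrDr mulrDl mulrA addrACA.
  - move=> _ [x [t fx ->]] /=; have [t0|t0|->] := ltgtP t 0.
    + have := le_c _ (fZ (- t)^-1 _ fx) => /=.
      have -> : (- t)^-1 *: x.1 - v = (- t)^-1 *: (x.1 + t *: v).
        by rewrite scalerDr scalerA invrN mulNr mulVf ?lt_eqF// scaleN1r.
      rewrite pZ ger0_norm ?invr_ge0 ?oppr_ge0 ?(ltW t0)// -mulrBr.
      rewrite ler_pdivrMl ?oppr_gt0//; lra.
    + have := c_le _ (fZ t^-1 _ fx) => /=.
      have -> : t^-1 *: x.1 + v = t^-1 *: (x.1 + t *: v).
        by rewrite scalerDr scalerA mulVf ?gt_eqF// scale1r.
      rewrite pZ ger0_norm ?invr_ge0 ?(ltW t0)// -mulrBr ler_pdivlMl//; lra.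
    + by rewrite scale0r mul0r !addr0; exact: fb.
split=> [x fx|]; first by exists x, 0 => //; rewrite scale0r mul0r addr0.
exists c; exists (0, 0), 1 => //; by rewrite scale1r mul1r add0r.
Qed.

(** Zorn's lemma is applied to graphs, for which the union of a chain is at once
    an upper bound. *)
Lemma hahn_banach (x0 : V) :
  exists l : {linear V -> R^o}, (forall x, l x <= p x) /\ l x0 = p x0.
Proof.
pose f0 : set (V * R) := [set (t *: x0, t * p x0) | t in [set: R]].
have [f [domf fmax]] : exists f, dominated (f `|` f0) /\
    forall g, f `<` g -> ~ dominated (g `|` f0).
  apply: (Zorn_bigcup (P := [set f | dominated (f `|` f0)])) => C CP Ctot.
  have f0l x y (a : R) : f0 x -> f0 y -> f0 (x + (a *: y.1, a * y.2)).
    move=> [s _ <-] [t _ <-]; exists (s + a * t) => //=.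
    by congr (_, _); rewrite /= ?scalerDl ?scalerA// mulrDl mulrA.
  have f0b x : f0 x -> x.2 <= p x.1.
    by move=> [s _ <-]/=; rewrite pZ ler_wpM2r// ler_norm.
  split.
  - by right; exists 0 => //; rewrite scale0r mul0r.
  - move=> x y a [[X CX Xx]|f0x] [[Y CY Yy]|f0y].
    + have [XY|YX] := Ctot _ _ CX CY.
      * have [_ /(_ x y a) h _] := CP _ CY.
        by have [|||] := h; [left; exact: XY|left|move=> ?; left; exists Y|right].
      * have [_ /(_ x y a) h _] := CP _ CX.
        by have [|||] := h; [left|left; exact: YX|move=> ?; left; exists X|right].
    + have [_ /(_ x y a) h _] := CP _ CX.
      by have [|||] := h; [left|right|move=> ?; left; exists X|right].
    + have [_ /(_ x y a) h _] := CP _ CY.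
      by have [|||] := h; [right|left|move=> ?; left; exists Y|right].
    + by right; exact: f0l.
  - move=> x [[X CX Xx]|/f0b//]; have [_ _ h] := CP _ CX.
    by apply: h; left.
pose g := f `|` f0.
have gtot v : exists c, g (v, c).
  have [h domh [gh [c hc]]] := dominated_extend v domf.
  exists c; apply: contrapT => gc; apply: (fmax h).
    split; first by move=> x fx; apply: gh; left.
    by move=> hf; apply: gc; left; exact: hf.
  suff -> : h `|` f0 = h by [].
  by apply/setUidPl => x f0x; apply: gh; right.
pose l (v : V) : R^o := xget 0 [set c | g (v, c)].
have gl v : g (v, l v).
  by have [c gc] := gtot v; exact: (@xgetI _ 0 [set c : R^o | g (v, c)] c gc).
have glE v c : g (v, c) -> l v = c.
  by move=> gc; exact: (dominated_fun domf (gl v) gc).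
have [g0 gD gb] := domf.
have ll : linear l.
  move=> a v w; apply: glE; rewrite ![a *: _ + _]addrC.
  exact: (gD _ _ a (gl w) (gl v)).
pose lm := GRing.isLinear.Build R V R^o *:%R l ll.
pose L : {linear V -> R^o} := HB.pack l lm.
exists L; split=> [x|]; first exact: (gb _ (gl x)).
by apply: glE; right; exists 1; rewrite ?scale1r ?mul1r.
Qed.

End HahnBanach.

Section Functionals.
Context {R : realType} {E : tvsType R}.

Lemma seminorm_functional (q : E -> R) (x : E) : continuous_seminorm q ->
  exists l : {linear E -> R^o},
    [/\ continuous l, forall y, `|l y| <= q y & l x = q x].
Proof.
move=> hq; have [l [lq lx]] := hahn_banach (seminormD hq) (seminormZ hq) x.
have lq' y : `|l y| <= q y.
  by rewrite ler_norml lq andbT lerNl -linearN -(seminormN hq) lq.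
exists l; split=> // y; apply/(@cvgrPdist_lt _ R^o) => e e0.
apply: filterS (seminorm_ball hq y e0) => z; apply: le_lt_trans.
by rewrite -linearB -seminormBC.
Qed.

Lemma functional_separates (x y : E) : hausdorff_space E ->
  (forall l : {linear E -> R^o}, continuous l -> l x = l y) -> x = y.
Proof.
move=> hE h; apply: seminorm_separates => // q hq.
have [l [lc _ <-]] := seminorm_functional (x - y) hq.
by rewrite linearB h// subrr.
Qed.

Lemma norm_functional_seminorm (l : {linear E -> R^o}) :
  continuous l -> continuous_seminorm (fun x => `|l x|).
Proof.
move=> lc; split=> [x y|r x|x].
- by rewrite linearD ler_normD.
- by rewrite linearZ normrM.
- by apply: (@cvg_norm _ R^o); exact: lc.
Qed.

End Functionals.

(** Compactness of a segment, in the form that replaces every choice of a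
    partition below: local estimates are summed up by concatenation. *)
Lemma segment_principle {R : realType} (P : R -> R -> Prop) (a b : R) :
  a <= b ->
  (forall s t u, a <= s -> s <= t -> t <= u -> u <= b ->
     P s t -> P t u -> P s u) ->
  (forall t, a <= t <= b -> exists2 d, 0 < d & forall s u,
     a <= s -> t - d < s -> s <= u -> u < t + d -> u <= b -> P s u) ->
  P a b.
Proof.
move=> ab Pcat loc.
pose A := [set t | a <= t <= b /\ P a t].
have Aa : A a.
  have [|d d0 h] := loc a; first by rewrite lexx.
  by split; [rewrite lexx|apply: h => //; lra].
have Aub : ubound A b by move=> t [/andP[]].
have hA : has_sup A by split; [exists a|exists b].
have sa : a <= sup A by apply: ub_le_sup => //; exact: hA.2.
have sb : sup A <= b by apply: ge_sup => //; exact: hA.1.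
have [|d d0 h] := loc (sup A); first by rewrite sa.
have [t [/andP[at_ tb] Pt] tA] := sup_adherent d0 hA.
have tsup : t <= sup A by apply: ub_le_sup; [exact: hA.2|split; rewrite ?at_].
pose u := Num.min b (sup A + d / 2).
have ub : u <= b by rewrite ge_min lexx.
have tu : t <= u by rewrite le_min tb/=; lra.
have Pu : P a u.
  apply: (Pcat a t u) => //; apply: h => //.
  by rewrite /u gt_min; apply/orP; right; lra.
have : u <= sup A.
  by apply: ub_le_sup; [exact: hA.2|split=> //; rewrite (le_trans at_ tu)].
have [bs|sb'] := leP b (sup A + d / 2).
  by move: Pu; rewrite /u min_l.
have -> : u = sup A + d / 2 by rewrite /u min_r ?ltW.
by move=> su; exfalso; lra.
Qed.

(** * Directional derivatives and the mean value theorem *)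

Lemma hausdorff_prod (T U : topologicalType) :
  hausdorff_space T -> hausdorff_space U -> hausdorff_space (T * U)%type.
Proof.
move=> hT hU [x y] [x' y'] h; congr (_, _).
- apply: hT => A B Ax Bx'.
  have [||[u v] []] := h (A `*` setT) (B `*` setT).
  + by exists (A, setT) => //; split=> //; exact: filterT.
  + by exists (B, setT) => //; split=> //; exact: filterT.
  by move=> [Au _] [Bu _]; exists u.
- apply: hU => A B Ay By'.
  have [||[u v] []] := h (setT `*` A) (setT `*` B).
  + by exists (setT, A) => //; split=> //; exact: filterT.
  + by exists (setT, B) => //; split=> //; exact: filterT.
  by move=> [_ Av] [_ Bv]; exists v.
Qed.

Lemma cvg_eqF {T : Type} {U : topologicalType} (F : set_system T) {FF : Filter F}
    (f g : T -> U) (l : U) :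
  (\forall t \near F, f t = g t) -> f @ F --> l -> g @ F --> l.
Proof.
move=> fg fl A /(cvg_near fl) Af; suff : \forall t \near F, A (g t) by [].
by apply: filterS2 fg Af => t <-.
Qed.

Lemma Cn_continuous {R : realType} n (E F : tvsType R) (U : set E) (f : E -> F) :
  Cn n U f -> forall x, U x -> {for x, continuous f}.
Proof. by case: n => [|n] // []. Qed.

Lemma near_neq0 {R : realType} (H : set_system R) :
  H --> (0 : R)^' -> \forall h \near H, h != 0.
Proof.
by move=> H0; apply: (H0 [set h | h != 0]); exact: (nbhs_dnbhs_neq (0 : R)).
Qed.

Section DirDeriv.
Context {R : realType} {E F : tvsType R}.
Implicit Types (f : E -> F) (U : set E).

Lemma dir_derivE f x y l : hausdorff_space F ->
  diff_quot f x y @ (0 : R)^' --> l -> dir_deriv f (x, y) = l.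
Proof.
move=> hF fl; apply: (cvg_unique hF) (fl).
exact: (@xgetI _ 0 [set l | diff_quot f x y @ (0 : R)^' --> l] l fl).
Qed.

Lemma dir_derivP f x y : has_dir_deriv f x y ->
  diff_quot f x y @ (0 : R)^' --> dir_deriv f (x, y).
Proof.
move=> [l fl].
exact: (@xgetI _ 0 [set l | diff_quot f x y @ (0 : R)^' --> l] l fl).
Qed.

Lemma dir_derivZ f x y (r : R) : hausdorff_space F -> has_dir_deriv f x y ->
  dir_deriv f (x, r *: y) = r *: dir_deriv f (x, y).
Proof.
move=> hF fxy; apply: dir_derivE => //; have [->|r0] := eqVneq r 0.
  rewrite scale0r (_ : diff_quot _ _ _ = cst 0) ?scale0r; first exact: cvg_cst.
  by apply/funext => h; rewrite /diff_quot scaler0 addr0 subrr scaler0.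
have -> : diff_quot f x (r *: y) = fun h => r *: diff_quot f x y (h * r).
  apply/funext => h; rewrite /diff_quot !scalerA invfM [r * _]mulrC mulrAC.
  by rewrite -mulrA mulfV// mulr1.
apply: tvs_cvgZ; first exact: cvg_cst.
apply: (cvg_comp (fun h => h * r) (diff_quot f x y) (G := (0 : R)^')); last first.
  exact: dir_derivP.
move=> A [e /= e0 eA]; exists (e / `|r|) => /=; first by rewrite divr_gt0 ?normr_gt0.
move=> h /=; rewrite sub0r normrN ltr_pdivlMr ?normr_gt0// => hr h0.
by apply: eA; rewrite /= ?mulf_neq0// sub0r normrN normrM.
Qed.

Lemma C1_has_dir_deriv n U f x y : Cn n.+1 U f -> U x -> has_dir_deriv f x y.
Proof. by case=> _ h _; exact: h. Qed.

Lemma C1_dir_deriv_continuous n U f x y : Cn n.+1 U f -> U x ->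
  {for (x, y), continuous (dir_deriv f)}.
Proof. by case=> _ _ h Ux; exact: (Cn_continuous h). Qed.

Lemma is_derive_line f (l : {linear F -> R^o}) (x y : E) (s : R) :
  continuous l -> has_dir_deriv f (x + s *: y) y ->
  is_derive s 1 (fun s : R => l (f (x + s *: y)) : R)
    (l (dir_deriv f (x + s *: y, y)) : R).
Proof.
move=> lc /dir_derivP h.
have {}h : (fun h : R => h^-1 *: (l (f (x + (h *: 1 + s) *: y)) - l (f (x + s *: y))))
    @ (0 : R)^' --> l (dir_deriv f (x + s *: y, y)).
  have := cvg_comp _ l h (lc _); apply: cvg_trans; apply: near_eq_cvg.
  near=> t; rewrite /= /diff_quot linearZ/= linearB; congr (_ *: (l (f _) - _)).
  by rewrite [_ *: 1]mulr1 scalerDl addrA addrAC -addrA addrCA addrA.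
split; first by apply/cvg_ex; exists (l (dir_deriv f (x + s *: y, y))).
by apply: cvg_lim => //; exact: Rhausdorff.
Unshelve. all: by end_near. Qed.

Lemma mean_value n U f (l : {linear F -> R^o}) (x y : E) :
  continuous l -> Cn n.+1 U f -> (forall s : R, 0 <= s <= 1 -> U (x + s *: y)) ->
  exists2 s : R, 0 <= s <= 1 &
    l (f (x + y)) - l (f x) = l (dir_deriv f (x + s *: y, y)).
Proof.
move=> lc fU xyU; pose g (s : R) : R := l (f (x + s *: y)).
pose dg (s : R) : R := l (dir_deriv f (x + s *: y, y)).
have gdg (s : R) : s \in `[0, 1]%R ->
    is_derive s 1 g (dg s).
  rewrite in_itv/= => /xyU/(C1_has_dir_deriv y fU) h.
  exact: is_derive_line.
have gdg' (s : R) : s \in `]0, 1[%R -> is_derive s 1 g (dg s).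
  by move=> /subset_itv_oo_cc; exact: gdg.
have gc : {within `[0, 1], continuous g}.
  by apply: derivable_within_continuous => s /gdg[].
have [s s01] := MVT_segment ler01 gdg' gc.
rewrite /g /dg scale1r scale0r addr0 subr0 mulr1 => h.
by exists s => //; move: s01; rewrite in_itv.
Qed.

(** Hahn-Banach turns the scalar mean value theorem into an estimate for a
    seminorm: the functional is chosen to attain the seminorm at the error. *)
Lemma mean_value_seminorm n U f (q : F -> R) (x y : E) (z : F) (c : R) :
  continuous_seminorm q -> Cn n.+1 U f ->
  (forall s : R, 0 <= s <= 1 ->
     U (x + s *: y) /\ q (dir_deriv f (x + s *: y, y) - z) <= c) ->
  q (f (x + y) - f x - z) <= c.
Proof.
move=> hq fU h; have [l [lc lq <-]] := seminorm_functional (f (x + y) - f x - z) hq.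
have [|s s01 e] := mean_value (x := x) (y := y) lc fU; first by move=> s /h[].
rewrite !linearB/= e -linearB (le_trans (ler_norm _))// (le_trans (lq _))//.
exact: (h _ s01).2.
Qed.

(** Letting base point and direction move with [h], this single limit contains
    the chain rule, derivatives along curves, and additivity in the direction. *)
Lemma cvg_diff_quot n U f (x y : E) (H : set_system R) {FH : Filter H}
    (u v : R -> E) :
  hausdorff_space F -> open U -> U x -> Cn n.+1 U f ->
  H --> (0 : R)^' -> u @ H --> x -> v @ H --> y ->
  (fun h : R => h^-1 *: (f (u h + h *: v h) - f (u h))) @ H
    --> dir_deriv f (x, y).
Proof.
move=> hF oU Ux fU H0 ux vy; apply: cvg_seminorm => q hq e e0.
have e20 : 0 < e / 2 by lra.
have [[A B] /= [Ax By] AB] :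
    nbhs (x, y) (dir_deriv f @^-1` [set z | q (z - dir_deriv f (x, y)) < e / 2]).
  exact: (C1_dir_deriv_continuous fU Ux (seminorm_ball hq _ e20)).
have Ux' : nbhs x U by exact: open_nbhs_nbhs.
have [p hp pAU] := nbhs_seminorm (filterI Ax Ux').
have p2 : 0 < 1 / 2 :> R by lra.
have hv : (fun h : R => h *: v h) @ H --> (0 : E).
  rewrite -(scale0r y); apply: tvs_cvgZ vy.
  by apply: cvg_trans H0 _; exact: (@nbhs_dnbhs R 0).
near=> h.
have h0 : h != 0.
  near: h; exact: near_neq0.
have pu : p (u h - x) < 1 / 2 by near: h; exact: (cvg_near ux (seminorm_ball hp _ p2)).
have pv : p (h *: v h - 0) < 1 / 2.
  by near: h; exact: (cvg_near hv (seminorm_ball hp _ p2)).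
have vB : B (v h) by near: h; exact: (cvg_near vy By).
have key : q (f (u h + h *: v h) - f (u h) - h *: dir_deriv f (x, y)) <= `|h| * (e / 2).
  apply: (mean_value_seminorm hq fU) => s s01.
  have [Aw Uw] : (A `&` U) (u h + s *: (h *: v h)).
    apply: pAU; rewrite addrAC (le_lt_trans (seminormD hp _ _))//.
    have -> : 1 = 1 / 2 + 1 / 2 :> R by field.
    rewrite ltr_leD// (seminormZ hp) ger0_norm; last by case/andP: s01.
    move: pv; rewrite subr0 => /ltW; apply: le_trans.
    by rewrite ler_piMl ?(seminorm_ge0 hp)//; case/andP: s01.
  split=> //; rewrite dir_derivZ//; last exact: (C1_has_dir_deriv _ fU).
  rewrite -scalerBr (seminormZ hq) ler_wpM2l// ltW//.
  exact: (AB (_, _)).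
have -> : h^-1 *: (f (u h + h *: v h) - f (u h)) - dir_deriv f (x, y) =
    h^-1 *: (f (u h + h *: v h) - f (u h) - h *: dir_deriv f (x, y)).
  by rewrite [RHS]scalerBr [h^-1 *: (h *: _)]scalerA mulVf// scale1r.
rewrite (seminormZ hq) normfV ltr_pdivrMl ?normr_gt0//.
by apply: le_lt_trans key _; rewrite ltr_pM2l ?normr_gt0//; lra.
Unshelve. all: by end_near. Qed.

End DirDeriv.

(** * The chain rule and C^n-maps *)

Section ChainRule.
Context {R : realType}.

Lemma dir_derivD (E F : tvsType R) n (U : set E) (f : E -> F) (x y z : E) :
  hausdorff_space F -> open U -> U x -> Cn n.+1 U f ->
  dir_deriv f (x, y + z) = dir_deriv f (x, y) + dir_deriv f (x, z).
Proof.
move=> hF oU Ux fU; apply: dir_derivE => //.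
(* The increment along [z] is taken at the moving base point [x + h *: y]. *)
have dz : (fun h : R => h^-1 *: (f (x + h *: y + h *: z) - f (x + h *: y)))
    @ (0 : R)^' --> dir_deriv f (x, z).
  apply: (cvg_diff_quot hF oU Ux fU); first exact: cvg_refl.
    exact: cvg_line.
  exact: cvg_cst.
have dy : (fun h : R => h^-1 *: (f (x + h *: y) - f x))
    @ (0 : R)^' --> dir_deriv f (x, y).
  by apply: (cvg_diff_quot hF oU Ux fU); [exact: cvg_refl|exact: cvg_cst..].
apply: (cvg_eqF _ (tvs_cvgD dy dz)); near=> h.
rewrite /diff_quot -scalerDr; congr (_ *: _).
by rewrite addrC addrA subrK scalerDr addrA.
Unshelve. all: by end_near. Qed.

Lemma cvg_diff_quot_comp (E F G : tvsType R) n (V : set F) (f : F -> G)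
    (g : E -> F) (x y : E) : hausdorff_space G -> open V -> V (g x) ->
  Cn n.+1 V f -> has_dir_deriv g x y ->
  diff_quot (f \o g) x y @ (0 : R)^' --> dir_deriv f (g x, dir_deriv g (x, y)).
Proof.
move=> hG oV Vgx fV /dir_derivP gxy.
have : (fun h : R => h^-1 *: (f (g x + h *: diff_quot g x y h) - f (g x)))
    @ (0 : R)^' --> dir_deriv f (g x, dir_deriv g (x, y)).
  by apply: (cvg_diff_quot hG oV Vgx fV) _ gxy; [exact: cvg_refl|exact: cvg_cst].
apply: cvg_eqF; near=> h; rewrite /diff_quot scalerA mulfV ?scale1r ?subrKC//.
by near: h; exact: near_neq0.
Unshelve. all: by end_near. Qed.

Lemma dir_deriv_comp (E F G : tvsType R) n (V : set F) (f : F -> G)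
    (g : E -> F) (x y : E) : hausdorff_space G -> open V -> V (g x) ->
  Cn n.+1 V f -> has_dir_deriv g x y ->
  dir_deriv (f \o g) (x, y) = dir_deriv f (g x, dir_deriv g (x, y)).
Proof.
move=> hG oV Vgx fV gxy; apply: (dir_derivE hG).
exact: (cvg_diff_quot_comp hG oV Vgx fV).
Qed.

Lemma has_deriv_comp (E F : tvsType R) n (U : set E) (f : E -> F) (I : set R)
    (g : R -> E) (t : R) (w : E) : hausdorff_space F -> open U -> U (g t) ->
  Cn n.+1 U f -> has_deriv I g t w ->
  has_deriv I (f \o g) t (dir_deriv f (g t, w)).
Proof.
move=> hF oU Ut fU gw; rewrite /has_deriv.
have FI : Filter (within [set h | I (t + h)] (0 : R)^') by exact: within_filter.
have h0 : within [set h | I (t + h)] (0 : R)^' --> (0 : R)^' by exact: cvg_within.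
have : (fun h : R => h^-1 *: (f (g t + h *: (h^-1 *: (g (t + h) - g t))) - f (g t)))
    @ within [set h | I (t + h)] (0 : R)^' --> dir_deriv f (g t, w).
  by apply: (cvg_diff_quot hF oU Ut fU h0) gw; exact: cvg_cst.
apply: cvg_eqF; apply: filterS (near_neq0 h0) => h h1.
by rewrite scalerA mulfV ?scale1r ?subrKC.
Qed.

End ChainRule.

Section CnTheory.
Context {R : realType}.

Lemma Cn_succ n : forall (E F : tvsType R) (U : set E) (f : E -> F),
  Cn n.+1 U f -> Cn n U f.
Proof.
elim: n => [|n IH] E F U f; first by case.
by move=> [fc fd fn]; split=> //; exact: IH.
Qed.

Lemma diff_quot_local (E F : tvsType R) (V : set E) (f g : E -> F) (x y : E)
    (l : F) : open V -> V x -> {in V, f =1 g} ->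
  (diff_quot f x y @ (0 : R)^' --> l) = (diff_quot g x y @ (0 : R)^' --> l).
Proof.
move=> oV Vx fg.
have near_eq : \forall h \near (0 : R)^', diff_quot f x y h = diff_quot g x y h.
  have Vx' : nbhs x V by exact: open_nbhs_nbhs.
  have xyV := cvg_near (@cvg_line _ _ x y) Vx'; near=> h'.
  rewrite /diff_quot !fg ?inE//; near: h'; exact: xyV.
apply/propext; split=> hl; apply: (cvg_eqF _ hl); first exact: near_eq.
by near=> h'; rewrite (near near_eq h').
Unshelve. all: by end_near. Qed.

Lemma dir_deriv_local (E F : tvsType R) (V : set E) (f g : E -> F) (x y : E) :
  open V -> V x -> {in V, f =1 g} -> dir_deriv f (x, y) = dir_deriv g (x, y).
Proof.
move=> oV Vx fg; congr (xget _ _); apply/funext => l.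
exact: (diff_quot_local _ _ oV).
Qed.

(** [dir_deriv] is a choice made from the germ of the map at the base point, so
    regularity may be checked on local representatives. *)
Lemma Cn_local n : forall (E F : tvsType R) (U : set E) (f : E -> F),
  (forall x, U x -> exists (V : set E) (g : E -> F),
     [/\ open V, V x, Cn n V g & {in V, f =1 g}]) -> Cn n U f.
Proof.
have cont n' (E F : tvsType R) (V : set E) (f g : E -> F) x :
    open V -> V x -> Cn n' V g -> {in V, f =1 g} -> {for x, continuous f}.
  move=> oV Vx gV fg; have gx := Cn_continuous gV Vx.
  have Vx' : nbhs x V by exact: open_nbhs_nbhs.
  change (f @ x --> f x); rewrite fg ?inE//; apply: (cvg_eqF _ gx).
  by apply: filterS Vx' => y Vy; rewrite fg ?inE.
elim: n => [|n IH] E F U f h.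
  by move=> x /h[V [g [oV Vx gV fg]]]; exact: (cont 0 _ _ V f g).
split.
- by move=> x /h[V [g [oV Vx gV fg]]]; exact: (cont n.+1 _ _ V f g).
- move=> x y /h[V [g [oV Vx gV fg]]].
  have [l gl] := C1_has_dir_deriv y gV Vx.
  by exists l; rewrite (diff_quot_local _ _ oV Vx fg).
- apply: IH => -[x y] [/h[V [g [oV Vx gV fg]]] _].
  exists (V `*` setT), (dir_deriv g); split=> //.
  + by apply: openX => //; exact: openT.
  + by case: gV.
  + move=> [x' y']; rewrite inE => -[/= Vx' _].
    exact: (dir_deriv_local _ oV Vx' fg).
Qed.

Lemma Cn_subset n (E F : tvsType R) (U V : set E) (f g : E -> F) :
  open V -> U `<=` V -> {in V, f =1 g} -> Cn n V g -> Cn n U f.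
Proof. by move=> oV UV fg gV; apply: Cn_local => x /UV Vx; exists V, g. Qed.

Lemma Cn_linear n : forall (E F : tvsType R) (U : set E) (L : E -> F),
  hausdorff_space F -> linear L -> continuous L -> Cn n U L.
Proof.
elim: n => [|n IH] E F U L hF Ll Lc; first by move=> x _; exact: Lc.
have Lxy x y : diff_quot L x y @ (0 : R)^' --> L y.
  apply: (cvg_eqF _ (cvg_cst (L y))); near=> h.
  rewrite /diff_quot [x + _]addrC Ll addrK scalerA mulVf ?scale1r//.
  by near: h; exact: near_neq0.
split; first by move=> x _; exact: Lc.
  by move=> x y _; exists (L y).
have -> : dir_deriv L = L \o snd.
  by apply/funext => -[x y]; exact: dir_derivE.
apply: IH => //; first by move=> a p q; rewrite /= -Ll.
by move=> p; apply: continuous_comp; [exact: cvg_snd|exact: Lc].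
Unshelve. all: by end_near. Qed.

Lemma Cn_fst n (E F : tvsType R) (U : set (E * F)) :
  hausdorff_space E -> Cn n U (fst : E * F -> E).
Proof. by move=> hE; apply: Cn_linear => // p; exact: cvg_fst. Qed.

Lemma Cn_snd n (E F : tvsType R) (U : set (E * F)) :
  hausdorff_space F -> Cn n U (snd : E * F -> F).
Proof. by move=> hE; apply: Cn_linear => // p; exact: cvg_snd. Qed.

Lemma Cn_cst n (E F : tvsType R) (U : set E) (c : F) :
  hausdorff_space F -> Cn n U (cst c).
Proof.
case: n => [|n] hF; first by move=> x _; exact: cvg_cst.
have cl x y : diff_quot (cst c : E -> F) x y @ (0 : R)^' --> (0 : F).
  rewrite (_ : diff_quot _ _ _ = cst 0); first exact: cvg_cst.
  by apply/funext => h; rewrite /diff_quot subrr scaler0.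
split; first by move=> x _; exact: cvg_cst.
  by move=> x y _; exists 0.
have -> : dir_deriv (cst c : E -> F) = (fun=> 0).
  by apply/funext => -[x y]; exact: dir_derivE.
apply: Cn_linear => //; first by move=> a x y; rewrite scaler0 addr0.
by move=> x; exact: cvg_cst.
Qed.

Lemma cvg_diff_quot_pair (E F G : tvsType R) (f : E -> F) (g : E -> G) (x y : E) :
  has_dir_deriv f x y -> has_dir_deriv g x y ->
  diff_quot (fun x => (f x, g x)) x y @ (0 : R)^' -->
    (dir_deriv f (x, y), dir_deriv g (x, y)).
Proof.
move=> /dir_derivP fl /dir_derivP gl.
exact: (cvg_pair (G := nbhs _) (H := nbhs _) fl gl).
Qed.

Lemma dir_deriv_pair (E F G : tvsType R) (f : E -> F) (g : E -> G) (x y : E) :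
  hausdorff_space F -> hausdorff_space G ->
  has_dir_deriv f x y -> has_dir_deriv g x y ->
  dir_deriv (fun x => (f x, g x)) (x, y) =
  (dir_deriv f (x, y), dir_deriv g (x, y)).
Proof.
move=> hF hG fl gl; apply: dir_derivE; first exact: hausdorff_prod.
exact: cvg_diff_quot_pair.
Qed.

Lemma Cn_pair n : forall (E F G : tvsType R) (U : set E) (f : E -> F) (g : E -> G),
  open U -> hausdorff_space F -> hausdorff_space G -> Cn n U f -> Cn n U g ->
  Cn n U (fun x => (f x, g x)).
Proof.
elim: n => [|n IH] E F G U f g oU hF hG fU gU.
  by move=> x Ux; apply: (cvg_pair (G := nbhs _) (H := nbhs _)); [exact: fU|exact: gU].
split.
- move=> x Ux; apply: (cvg_pair (G := nbhs _) (H := nbhs _)).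
    exact: (Cn_continuous fU).
  exact: (Cn_continuous gU).
- move=> x y Ux; exists (dir_deriv f (x, y), dir_deriv g (x, y)).
  apply: cvg_diff_quot_pair; first exact: (C1_has_dir_deriv _ fU).
  exact: (C1_has_dir_deriv _ gU).
- have oUT : open (U `*` [set: E]) by apply: openX => //; exact: openT.
  apply: (Cn_subset (g := fun p => (dir_deriv f p, dir_deriv g p)) oUT) => //.
    move=> [x y]; rewrite inE => -[/= Ux _]; apply: dir_deriv_pair => //.
      exact: (C1_has_dir_deriv _ fU).
    exact: (C1_has_dir_deriv _ gU).
  by case: fU => _ _ fU; case: gU => _ _ gU; exact: IH.
Qed.

(** The derivative of [f \o g] at [(x, y)] is that of [f] at the point
    [(g x, dg (x, y))], again a composition, so that the induction closes
    because it ranges over all spaces at once. *)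
Lemma Cn_comp n : forall (E F G : tvsType R) (U : set E) (V : set F)
    (f : F -> G) (g : E -> F),
  open U -> open V -> hausdorff_space E -> hausdorff_space F ->
  hausdorff_space G -> Cn n V f -> Cn n U g -> (forall x, U x -> V (g x)) ->
  Cn n U (f \o g).
Proof.
elim: n => [|n IH] E F G U V f g oU oV hE hF hG fV gU UV.
  by move=> x Ux; apply: continuous_comp; [exact: gU|exact/fV/UV].
split.
- move=> x Ux; apply: continuous_comp; first exact: (Cn_continuous gU).
  exact: (Cn_continuous fV (UV _ Ux)).
- move=> x y Ux; exists (dir_deriv f (g x, dir_deriv g (x, y))).
  apply: (cvg_diff_quot_comp hG oV _ fV); first exact: UV.
  exact: (C1_has_dir_deriv _ gU).
- have oUT : open (U `*` [set: E]) by apply: openX => //; exact: openT.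
  have oVT : open (V `*` [set: F]) by apply: openX => //; exact: openT.
  have hEE := hausdorff_prod hE hE; have hFF := hausdorff_prod hF hF.
  apply: (Cn_subset (g := dir_deriv f \o (fun p => ((g \o fst) p, dir_deriv g p)))
    oUT) => //.
    move=> [x y]; rewrite inE => -[/= Ux _].
    apply: (dir_deriv_comp hG oV _ fV); first exact: UV.
    exact: (C1_has_dir_deriv _ gU).
  have gU' := Cn_succ gU; case: fV => _ _ fV; case: gU => _ _ gU.
  apply: (IH _ _ _ _ _ _ _ oUT oVT) => //; last by move=> [x y] [/= /UV ? _].
  apply: Cn_pair => //; apply: (IH _ _ _ _ U g fst) => //; last by move=> ? [].
  exact: Cn_fst.
Qed.

End CnTheory.

(** * Local bounds for differentials *)

Section LocalBounds.
Context {R : realType}.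

Lemma add_continuous_seminorm (E : tvsType R) (p q : E -> R) :
  continuous_seminorm p -> continuous_seminorm q ->
  continuous_seminorm (fun x => p x + q x).
Proof.
move=> hp hq; split=> [x y|r x|x].
- by have := seminormD hp x y; have := seminormD hq x y; lra.
- by rewrite (seminormZ hp) (seminormZ hq) mulrDr.
- apply: (@cvgD _ R^o); first exact: (seminorm_continuous hp).
  exact: (seminorm_continuous hq).
Qed.

Lemma comp_continuous_seminorm (E F : tvsType R) (q : F -> R) (L : E -> F) :
  continuous_seminorm q -> linear L -> continuous L ->
  continuous_seminorm (fun x => q (L x)).
Proof.
move=> hq Ll Lc; split=> [x y|r x|x].
- by rewrite -{1}[x]scale1r Ll scale1r (seminormD hq).
- have L0 : L 0 = 0 by have := Ll (-1) 0 0; rewrite scaler0 addr0 scaleN1r addNr.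
  by rewrite -[r *: x]addr0 Ll L0 addr0 (seminormZ hq).
- by apply: continuous_comp; [exact: Lc|exact: (seminorm_continuous hq)].
Qed.

Lemma seminorm_ball_convex (E : tvsType R) (q : E -> R) (x0 x y : E) (s : R) :
  continuous_seminorm q -> 0 <= s <= 1 -> q (x - x0) < 1 -> q (x + y - x0) < 1 ->
  q (x + s *: y - x0) < 1.
Proof.
move=> hq /andP[s0 s1] qx qy.
have -> : x + s *: y - x0 = (1 - s) *: (x - x0) + s *: (x + y - x0).
  rewrite [RHS]addrC scalerBl scale1r addrCA -scalerBr opprB addrA subrK.
  by rewrite [x + y]addrC addrK addrAC.
apply: le_lt_trans (seminormD hq _ _) _; rewrite !(seminormZ hq).
rewrite !ger0_norm ?subr_ge0//.
have [->|s0'] := eqVneq s 0; first by rewrite subr0 mul1r mul0r addr0.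
have sp : 0 < s by rewrite lt_neqAle eq_sym s0'.
have : s * q (x + y - x0) < s by rewrite -[ltRHS]mulr1 ltr_pM2l.
have : (1 - s) * q (x - x0) <= 1 - s by rewrite ler_piMr ?subr_ge0// ltW.
lra.
Qed.

Section PairEmbeddings.
Variables E F : tvsType R.

Lemma linear_pair0r : linear (fun x : E => (x, 0 : F)).
Proof. by move=> a x y; congr (_, _); rewrite /= scaler0 addr0. Qed.

Lemma linear_pair0l : linear (fun x : F => (0 : E, x)).
Proof. by move=> a x y; congr (_, _); rewrite /= scaler0 addr0. Qed.

Lemma continuous_pair0r : continuous (fun x : E => (x, 0 : F)).
Proof.
move=> x; apply: (cvg_pair (G := nbhs x) (H := nbhs (0 : F))); first exact: cvg_id.
exact: cvg_cst.
Qed.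

Lemma continuous_pair0l : continuous (fun x : F => (0 : E, x)).
Proof.
move=> x; apply: (cvg_pair (G := nbhs (0 : E)) (H := nbhs x)); last exact: cvg_id.
exact: cvg_cst.
Qed.

End PairEmbeddings.

(** Rescale [v] into the open unit ball by any [t > p v]; one cannot divide by
    [p v] itself, since [p] may vanish at [v]. *)
Lemma homogeneous_bound (E : tvsType R) (p g : E -> R) (c : R) :
  continuous_seminorm p -> 0 <= c ->
  (forall (r : R) v, g (r *: v) = `|r| * g v) ->
  (forall v, p v < 1 -> g v <= c) -> forall v, g v <= c * p v.
Proof.
move=> hp c0 gZ gc v.
have scaled t : p v < t -> g v <= c * t.
  move=> vt; have t0 := le_lt_trans (seminorm_ge0 hp v) vt.
  have : p (t^-1 *: v) < 1.
    by rewrite (seminormZ hp) ger0_norm ?invr_ge0 ?(ltW t0)// ltr_pdivrMl// mulr1.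
  move/gc; rewrite gZ ger0_norm ?invr_ge0 ?(ltW t0)// ler_pdivrMl//; lra.
move: c0; rewrite le_eqVlt => /predU1P[c0|c0].
  by have := scaled (p v + 1); rewrite -c0 !mul0r; apply; lra.
apply/unstable.ler_gtP => z; rewrite -ltr_pdivlMl// => /scaled.
by rewrite mulrA mulfV ?mul1r ?gt_eqF.
Qed.

(** Continuity of the differential at [(x0, 0)] and homogeneity in the
    direction. *)
Lemma C1_bound (E F : tvsType R) n (U : set E) (f : E -> F) (q : F -> R) (x0 : E) :
  hausdorff_space F -> open U -> U x0 -> Cn n.+1 U f -> continuous_seminorm q ->
  exists2 p : E -> R, continuous_seminorm p &
    (forall x, p (x - x0) < 1 -> U x /\ forall v, q (dir_deriv f (x, v)) <= p v).
Proof.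
move=> hF oU Ux0 fU hq.
have d0 : dir_deriv f (x0, 0) = 0.
  have := dir_derivZ 0 hF (C1_has_dir_deriv 0 fU Ux0).
  by rewrite scaler0 scale0r.
have [[A B] /= [Ax B0] AB] :
    nbhs (x0, 0 : E) (dir_deriv f @^-1` [set z | q z < 1]).
  apply: (C1_dir_deriv_continuous fU Ux0); rewrite d0.
  have := seminorm_ball hq 0 ltr01; apply: filterS => z.
  by rewrite subr0.
have [p1 hp1 p1A] := nbhs_seminorm (filterI Ax (open_nbhs_nbhs (conj oU Ux0))).
have [p2 hp2 p2B] := nbhs_seminorm B0.
exists (fun x => p1 x + p2 x); first exact: add_continuous_seminorm.
move=> x xx0.
have [Axx Ux] : (A `&` U) x.
  by apply: p1A; apply: le_lt_trans xx0; rewrite lerDl (seminorm_ge0 hp2).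
split=> // v; rewrite -[leRHS]mul1r.
apply: (homogeneous_bound (g := fun v => q (dir_deriv f (x, v)))
  (add_continuous_seminorm hp1 hp2)) => //.
  move=> r w; rewrite dir_derivZ// ?(seminormZ hq)//.
  exact: (C1_has_dir_deriv _ fU).
move=> w pw; apply/ltW/(AB (x, w)); split=> //=; apply: p2B; rewrite subr0.
by apply: le_lt_trans pw; rewrite lerDr (seminorm_ge0 hp1).
Qed.

Lemma dir_deriv2Z (E F : tvsType R) n (U : set E) (f : E -> F) (x v w : E) (r : R) :
  hausdorff_space F -> open U -> U x -> Cn n.+2 U f ->
  dir_deriv (dir_deriv f) ((x, r *: v), (w, 0)) =
  r *: dir_deriv (dir_deriv f) ((x, v), (w, 0)).
Proof.
move=> hF oU Ux fU; apply: dir_derivE => //.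
have fU2 : Cn n.+1 (U `*` [set: E]) (dir_deriv f) by case: fU.
have /dir_derivP fl := C1_has_dir_deriv (w, 0 : E) fU2 (conj Ux I : _ (x, v)).
have rl : (fun h : R => r *: diff_quot (dir_deriv f) (x, v) (w, 0 : E) h)
    @ (0 : R)^' --> r *: dir_deriv (dir_deriv f) ((x, v), (w, 0)).
  by apply: tvs_cvgZ fl; exact: cvg_cst.
apply: (cvg_eqF _ rl).
have Ux' : nbhs x U by exact: open_nbhs_nbhs.
have xwU := cvg_near (@cvg_line _ _ x w) Ux'; near=> h.
have Uxw : U (x + h *: w) by near: h; exact: xwU.
rewrite /diff_quot !scalerA mulrC -scalerA; congr (_ *: _).
have e (u : E) : (x, u) + h *: (w, 0 : E) = (x + h *: w, u).
  by congr (_, _) => /=; rewrite scaler0 addr0.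
by rewrite !e !dir_derivZ ?scalerBr//; exact: (C1_has_dir_deriv _ fU).
Unshelve. all: by end_near. Qed.

(** Near [x0] the second differential is bounded by a product of seminorms.  By
    the mean value theorem along the base point this is a Lipschitz estimate,
    uniform on seminorm balls of directions; C^1-maps need not satisfy one. *)
Lemma C2_bound (E F : tvsType R) n (U : set E) (f : E -> F)
    (l : {linear F -> R^o}) (x0 : E) :
  hausdorff_space F -> open U -> U x0 -> Cn n.+2 U f -> continuous l ->
  exists p : E -> R, [/\ continuous_seminorm p, forall x, p (x - x0) < 1 -> U x &
    forall x y, p (x - x0) < 1 -> p (y - x0) < 1 -> forall v,
    `|l (dir_deriv f (y, v)) - l (dir_deriv f (x, v))| <= p (y - x) * p v].
Proof.
move=> hF oU Ux0 fU lc.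
have fU2 : Cn n.+1 (U `*` [set: E]) (dir_deriv f) by case: fU.
have oUT : open (U `*` [set: E]) by apply: openX => //; exact: openT.
have [P hP PU] := C1_bound (x0 := (x0, 0 : E)) hF oUT (conj Ux0 I) fU2
  (norm_functional_seminorm lc).
pose p x := P (x, 0 : E) + P (0 : E, x).
have hp : continuous_seminorm p.
  apply: add_continuous_seminorm.
    exact: comp_continuous_seminorm hP (@linear_pair0r _ _) (@continuous_pair0r _ _).
  exact: comp_continuous_seminorm hP (@linear_pair0l _ _) (@continuous_pair0l _ _).
have pP1 x : P (x, 0) <= p x by rewrite lerDl (seminorm_ge0 hP).
have pP2 x : P (0, x) <= p x by rewrite lerDr (seminorm_ge0 hP).
pose p2 x := p x + p x.
have hp2 : continuous_seminorm p2 by exact: add_continuous_seminorm.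
have p_ge0 := seminorm_ge0 hp.
(* The second differential is bilinear in [(v, w)]: its bound by [p w] for
   small [v] extends to all [v] by homogeneity. *)
have bil x v w : p2 (x - x0) < 1 ->
    `|l (dir_deriv (dir_deriv f) ((x, v), (w, 0)))| <= p2 w * p2 v.
  rewrite /p2 => xx0; have px : p (x - x0) < 1 / 2 by lra.
  have small u : p2 u < 1 -> P ((x, u) - (x0, 0)) < 1.
    move=> pu; have := seminormD hP (x - x0, 0) (0, u - 0).
    rewrite -[(x - x0, 0) + _]/(x - x0 + 0, 0 + (u - 0)) addr0 add0r subr0 => h.
    rewrite -[(x, u) - _]/(x - x0, u - 0) subr0 (le_lt_trans h)//.
    by move: pu; rewrite /p2; have := pP1 (x - x0); have := pP2 u; lra.
  apply: (homogeneous_bound (g := fun v =>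
    `|l (dir_deriv (dir_deriv f) ((x, v), (w, 0)))|) hp2).
  - by rewrite addr_ge0.
  - move=> r u; have [|Ux _] := PU (x, 0 : E).
      by apply: small; rewrite /p2 (seminorm0 hp); lra.
    rewrite (dir_deriv2Z _ _ _ hF oU _ fU); last by case: Ux.
    by rewrite linearZ normrM.
  - move=> u /small/PU[_ /(_ (w, 0))] h; apply: le_trans h _.
    by apply: le_trans (pP1 w) _; rewrite lerDl.
have U2 z : p2 (z - x0) < 1 -> U z.
  rewrite /p2 => h; have [|[]//] := PU (z, 0 : E).
  rewrite -[(z, 0) - _]/(z - x0, 0 - 0) subrr.
  by have := pP1 (z - x0); have := p_ge0 (z - x0); lra.
exists p2; split=> // x y xx0 yx0 v.
have seg (s : R) : 0 <= s <= 1 -> p2 (x + s *: (y - x) - x0) < 1.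
  by move=> s01; apply: seminorm_ball_convex; rewrite ?subrKC.
have [|s s01] := mean_value (x := (x, v)) (y := (y - x, 0 : E)) lc fU2.
  move=> s /seg/U2 h; split => //=; exact: h.
rewrite -[(x, v) + (y - x, 0)]/(x + (y - x), v + 0) addr0 subrKC => ->.
rewrite -[(x, v) + s *: _]/(x + s *: (y - x), v + s *: 0) scaler0 addr0.
exact/bil/seg.
Qed.

End LocalBounds.

(** * Borel curves with separable range *)

Section Separability.
Context {R : realType}.

Definition separable_set (T : topologicalType) (A : set T) : Prop :=
  exists D : set T, [/\ countable D, D `<=` A & A `<=` closure D].

Lemma metrizable_prod (T U : topologicalType) :
  metrizable R T -> metrizable R U -> metrizable R (T * U)%type.
Proof.
move=> [d [d0 dC dD dn]] [e [e0 eC eD en]].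
have d_ge0 x y : 0 <= d x y.
  have := dD x y x; rewrite (dC y x) (proj2 (d0 x x))//; lra.
have e_ge0 x y : 0 <= e x y.
  have := eD x y x; rewrite (eC y x) (proj2 (e0 x x))//; lra.
exists (fun p q => d p.1 q.1 + e p.2 q.2); split.
- move=> [x y] [x' y'] /=; split=> [h|[-> ->]].
    have := d_ge0 x x'; have := e_ge0 y y' => ? ?.
    by congr (_, _); [apply/d0|apply/e0]; lra.
  by rewrite (proj2 (d0 _ _))// (proj2 (e0 _ _))// addr0.
- by move=> p q; rewrite dC eC.
- move=> p q r; have := dD p.1 q.1 r.1; have := eD p.2 q.2 r.2; lra.
- move=> [x y] A; split.
  + move=> [[B C] /= [/dn[r r0 rB] /en[s s0 sC]] BCA].
    exists (Num.min r s); first by rewrite lt_min r0.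
    move=> [x' y'] /=; rewrite lt_min => /andP[xr ys].
    apply: BCA; split=> /=; [apply: rB|apply: sC].
      by have := e_ge0 y y'; lra.
    by have := d_ge0 x x'; lra.
  + move=> [r r0 rA].
    exists ([set x' | d x x' < r / 2], [set y' | e y y' < r / 2]) => /=.
      by split; [apply/dn; exists (r / 2)|apply/en; exists (r / 2)] => //; lra.
    by move=> [x' y'] [/= dx ey]; apply: rA => /=; lra.
Qed.

(** Keep one point of [A] in each ball of radius [1 / (n + 1)] around a point of
    the countable dense set, when there is one. *)
Lemma separable_subset (T : topologicalType) (A B : set T) :
  metrizable R T -> A `<=` B -> separable_set B -> separable_set A.
Proof.
move=> [d [d0 dC dD dn]] AB [D [cD DB BD]].
pose w n : R := n.+1%:R^-1.
pose P (z : T * nat) y := A y /\ d z.1 y < w z.2.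
pose K := [set z : T * nat | D z.1 /\ exists y, P z y].
have /choice[h hP] : forall z, exists y, K z -> P z y.
  move=> z; have [[_ [y Py]]|nK] := pselect (K z); first by exists y.
  by exists z.1.
exists (h @` K); split.
- apply: sub_countable (card_image_le _ _) _.
  apply: (sub_countable (B := D `*` [set: nat])); last by apply: countableX.
  by apply: subset_card_le => -[x n] [].
- by move=> _ [z Kz <-]; case: (hP z Kz).
- move=> a Aa U /dn[r r0 rU].
  have [n nr] : exists n : nat, w n < r / 2.
    have r20 : 0 < r / 2 by lra.
    have [n _ nP] := near_infty_natSinv_lt (PosNum r20).
    by exists n; exact: (nP n (leqnn n)).
  have [|x [Dx ax]] := BD a (AB a Aa) [set y | d a y < w n].
    by apply/dn; exists (w n) => //; rewrite /w.
  have Kx : K (x, n) by split=> //; exists a; split=> //; rewrite /= dC.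
  have [_ /= xb] := hP _ Kx.
  exists (h (x, n)); split; first by exists (x, n).
  by apply: rU; have := dD a x (h (x, n)); move: ax => /=; lra.
Qed.

Lemma separable_image (T U : topologicalType) (A : set T) (f : T -> U) :
  {within A, continuous f} -> separable_set A -> separable_set (f @` A).
Proof.
move=> /subspace_continuousP fc [D [cD DA AD]]; exists (f @` D); split.
- exact: sub_countable (card_image_le _ _) cD.
- exact: image_subset.
- move=> _ [x Ax <-] B /(fc x Ax) xB.
  have [y [Dy yB]] := AD _ Ax _ xB.
  by exists (f y); split; [exists y|exact/yB/DA].
Qed.

Lemma separable_prod (T U : topologicalType) (A : set T) (B : set U) :
  separable_set A -> separable_set B -> separable_set (A `*` B).
Proof.
move=> [D [cD DA AD]] [D' [cD' DB BD]]; exists (D `*` D'); split.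
- exact: countableX.
- by move=> [x y] [/DA ? /DB ?].
- move=> [x y] [/= /AD Ax /BD By] C [[V W] /= [/Ax[x' [Dx Vx]] /By[y' [Dy Wy]]] VWC].
  by exists (x', y'); split=> //; exact: VWC.
Qed.

Lemma metrizable_real : metrizable R R.
Proof.
exists (fun x y => `|x - y|); split.
- move=> x y; split=> [/eqP|->]; last by rewrite subrr normr0.
  by rewrite normr_eq0 subr_eq0 => /eqP.
- by move=> x y; rewrite distrC.
- by move=> x y z; rewrite (le_trans _ (ler_normD _ _))// addrA subrK.
- by move=> x A; rewrite -(@nbhs_ballE _ R); split=> -[r /= r0 rA]; exists r.
Qed.

Lemma separable_real (A : set R) : separable_set A.
Proof.
apply: (separable_subset metrizable_real (@subsetT _ A)).
exists (@ratr R @` setT); split=> //.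
  exact: sub_countable (card_image_le _ _) (countableP _).
move=> x _ B /= xB; move: (xB); rewrite nbhsE => -[V [oV Vx] VB].
have [y [Vy [q _ qy]]] := dense_rat (ex_intro _ x Vx) oV.
by exists y; split; [exists q|exact: VB].
Qed.

End Separability.

Section BorelCurves.
Context {R : realType}.
Local Notation mu := (@lebesgue_measure R).

Lemma countable_bigcup_measurable d (S : sigmaRingType d) (U : Type) (D : set U)
    (F : U -> set S) : countable D -> (forall i, D i -> measurable (F i)) ->
  measurable (\bigcup_(i in D) F i).
Proof.
move=> /countable_injP[f finj] mF.
have -> : \bigcup_(i in D) F i =
    \bigcup_n \bigcup_(i in D `&` [set i | f i = n]) F i.
  apply/seteqP; split=> [x [i Di Fx]|x [n _ [i [Di _] Fx]]]; last by exists i.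
  by exists (f i) => //; exists i.
apply: bigcupT_measurable => n.
have [[i [Di fi]]|noi] := pselect (exists i, D i /\ f i = n).
  rewrite (_ : \bigcup_(_ in _) _ = F i); first exact: mF.
  apply/seteqP; split=> [x [j [Dj fj]]|x Fx]; last by exists i.
  by rewrite (finj j i) ?inE// fj fi.
rewrite (_ : \bigcup_(_ in _) _ = set0)// -subset0 => x [i [Di fi] _].
by apply: noi; exists i.
Qed.

(** The part of membership in L^1 that is stable under composition with
    continuous maps. *)
Definition borel_separable (E : topologicalType) (D : set R) (g : R -> E) : Prop :=
  (forall B : set E, <<s @open E >> B -> measurable (D `&` g @^-1` B)) /\
  separable_set (g @` D).

Lemma borel_open (E : topologicalType) (D : set R) (g : R -> E) : measurable D ->
  (forall B : set E, open B -> measurable (D `&` g @^-1` B)) ->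
  forall B : set E, <<s @open E >> B -> measurable (D `&` g @^-1` B).
Proof.
move=> mD mg; apply: smallest_sub => //; split.
- by rewrite preimage_set0 setI0.
- move=> A mA; rewrite (_ : _ `&` _ = D `\` (D `&` g @^-1` A)).
    exact: measurableD.
  apply/seteqP; split=> [x [Dx [_ nA]]|x [Dx nA]]; split=> //.
    by move=> [_].
  by split=> // Ax; apply: nA.
- move=> A mA; rewrite preimage_bigcup setI_bigcupr.
  exact: bigcupT_measurable.
Qed.

Lemma borel_separable_continuous (E : topologicalType) (D : set R) (g : R -> E) :
  measurable D -> {within D, continuous g} -> borel_separable D g.
Proof.
move=> mD gc; split; last by apply: separable_image => //; exact: separable_real.
apply: borel_open => // B oB.
have /open_subspaceP[V oV VD] : open (g @^-1` B : set (subspace D)).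
  by move/continuousP: gc => h; exact: h.
by rewrite setIC -VD; apply: measurableI => //; exact: open_measurable.
Qed.

(** The range of a pair is covered by countably many rectangles inside any
    given open set, which makes the pair Borel measurable; the Borel sets of a
    product are in general not generated by rectangles. *)
Lemma borel_separable_pair (E F : topologicalType) (D : set R) (f : R -> E)
    (g : R -> F) : metrizable R E -> metrizable R F -> measurable D ->
  borel_separable D f -> borel_separable D g ->
  borel_separable D (fun t => (f t, g t)).
Proof.
move=> mE mF mD [mf sf] [mg sg]; split; last first.
  apply: (separable_subset (metrizable_prod mE mF)) (separable_prod sf sg).
  by move=> _ [t Dt <-]; split; exists t.
apply: borel_open => // B oB.
move: mE mF => [d [d0 dC dD dn]] [e [e0 eC eD en]].
have d_nbhs x (r : R) : 0 < r -> nbhs x [set y | d x y < r].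
  by move=> r0; apply/dn; exists r.
have e_nbhs x (r : R) : 0 < r -> nbhs x [set y | e x y < r].
  by move=> r0; apply/en; exists r.
have [K [cK _ KD]] := sf; have [L [cL _ LD]] := sg.
pose w n : R := n.+1%:R^-1.
pose P (z : E * F * nat) := [set p : E * F |
  interior [set y | d z.1.1 y < w z.2] p.1 /\
  interior [set y | e z.1.2 y < w z.2] p.2].
pose Z := [set z : E * F * nat | K z.1.1 /\ L z.1.2 /\ P z `<=` B].
have -> : D `&` (fun t => (f t, g t)) @^-1` B =
    \bigcup_(z in Z) (D `&` (fun t => (f t, g t)) @^-1` P z).
  apply/seteqP; split=> [t [Dt Bt]|t [z [_ [_ zB]] [Dt /zB]]]; last by split.
  have : nbhs (f t, g t) B by exact: open_nbhs_nbhs.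
  move=> [[V W] /= [/dn[r r0 rV] /en[s s0 sW]] VWB].
  have m0 : 0 < Num.min r s / 2 by rewrite divr_gt0// lt_min r0.
  have [n nm] : exists n : nat, w n < Num.min r s / 2.
    have [n _ nP] := near_infty_natSinv_lt (PosNum m0).
    by exists n; exact: (nP n (leqnn n)).
  have n0 : 0 < w n by rewrite /w.
  have nr : w n < r / 2.
    by apply: lt_le_trans nm _; rewrite ler_pM2r// ge_min lexx.
  have ns : w n < s / 2.
    by apply: lt_le_trans nm _; rewrite ler_pM2r// ge_min lexx orbT.
  have n20 : 0 < w n / 2 by lra.
  have [x [Kx fx]] := KD _ (imageP f Dt) _ (d_nbhs (f t) _ n20).
  have [y [Ly gy]] := LD _ (imageP g Dt) _ (e_nbhs (g t) _ n20).
  have Pt : P (x, y, n) (f t, g t).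
    split; rewrite /interior/=; [apply/dn|apply/en]; exists (w n / 2) => //.
      by move=> z /=; have := dD x (f t) z; move: fx; rewrite /= dC; lra.
    by move=> z /=; have := eD y (g t) z; move: gy; rewrite /= eC; lra.
  exists (x, y, n) => //; split=> //=; split=> // -[u v] [/= /interior_subset/= xu].
  move=> /interior_subset/= yv; apply: VWB; split=> /=; [apply: rV|apply: sW].
    by have := dD (f t) x u; move: fx => /=; lra.
  by have := eD (g t) y v; move: gy => /=; lra.
apply: countable_bigcup_measurable.
  apply: (sub_countable (B := K `*` L `*` [set: nat])).
    by apply: subset_card_le => -[[x y] n] [? [? _]].
  by apply: countableX => //; exact: countableX.
move=> z _; have -> : D `&` (fun t => (f t, g t)) @^-1` P z =
    (D `&` f @^-1` interior [set y | d z.1.1 y < w z.2]) `&`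
    (D `&` g @^-1` interior [set y | e z.1.2 y < w z.2]).
  by rewrite setIACA setIid.
apply: measurableI; [apply: mf|apply: mg]; apply: sub_gen_smallest;
  exact: open_interior.
Qed.

Lemma borel_separable_comp (E F : topologicalType) (D : set R) (U : set E)
    (g : R -> E) (f : E -> F) : measurable D -> open U ->
  (forall x, U x -> {for x, continuous f}) -> (forall t, D t -> U (g t)) ->
  borel_separable D g -> borel_separable D (f \o g).
Proof.
move=> mD oU fc DU [mg sg]; split.
  apply: borel_open => // B oB.
  have -> : D `&` (f \o g) @^-1` B = D `&` g @^-1` (U `&` f @^-1` B).
    by apply/seteqP; split=> t [Dt] /=; [split=> //; split=> //; exact: DU|case].
  apply: mg; apply: sub_gen_smallest.
  rewrite openE => x [Ux Bx]; apply: filterI; first exact: open_nbhs_nbhs.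
  by apply: fc => //; exact: open_nbhs_nbhs.
rewrite -image_comp; apply: separable_image => //.
apply/subspace_continuousP => _ [t Dt <-].
by apply: cvg_trans (fc _ (DU _ Dt)); apply: cvg_app; exact: cvg_within.
Qed.

Lemma borel_separable_sub (E : topologicalType) (D D' : set R) (g : R -> E) :
  metrizable R E -> measurable D' -> D' `<=` D -> borel_separable D g ->
  borel_separable D' g.
Proof.
move=> mE mD' DD [mg sg]; split.
  move=> B /mg mB; rewrite -(setIidl DD) -setIA; exact: measurableI.
by apply: (separable_subset mE) sg; exact: image_subset.
Qed.

Lemma borel_separable_measurable (D : set R) (g : R -> R) : measurable D ->
  borel_separable D g -> measurable_fun D g.
Proof.
move=> mD [mg _]; apply: (measurability _ (RGenOpens.measurableE R)) => //.
move=> _ [_ [a [b ->] <-]]; apply: mg; apply: sub_gen_smallest.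
exact: interval_open.
Qed.

End BorelCurves.

(** * Weak primitives *)

Section Integration.
Context {R : realType}.
Local Notation mu := (@lebesgue_measure R).
Implicit Types (a b s t u : R).

Lemma Rintegral_cat (f : R -> R) s t u : s <= t -> t <= u ->
  mu.-integrable `[s, u]%classic (EFin \o f) ->
  \int[mu]_(x in `[s, u]%classic) f x =
  \int[mu]_(x in `[s, t]%classic) f x + \int[mu]_(x in `[t, u]%classic) f x.
Proof.
move=> st tu fi; apply/eqP; rewrite addrC -subr_eq; apply/eqP.
rewrite Rintegral_itvB ?bnd_simp// Rintegral_itv_obnd_cbnd//.
apply: integrableS fi => //; apply: subset_itvr; by rewrite bnd_simp.
Qed.

Lemma L1_borel_separable (E : tvsType R) a b (g : R -> E) :
  L1 a b g -> borel_separable `[a, b]%classic g.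
Proof. by case. Qed.

Lemma L1_seminorm_integrable (E : tvsType R) a b (g : R -> E) (q : E -> R) :
  continuous_seminorm q -> L1 a b g ->
  mu.-integrable `[a, b]%classic (EFin \o (q \o g)).
Proof.
move=> hq [mg sg gi]; apply/integrableP; split.
  apply/measurable_EFinP; apply: borel_separable_measurable => //.
  apply: (borel_separable_comp (U := setT)) => //; first exact: openT.
  by move=> x _; exact: (seminorm_continuous hq).
under eq_integral do rewrite /= ger0_norm ?(seminorm_ge0 hq)//.
exact: gi.
Qed.

Lemma L1_functional_integrable (E : tvsType R) a b (g : R -> E)
    (l : {linear E -> R^o}) : continuous l -> L1 a b g ->
  mu.-integrable `[a, b]%classic (EFin \o (fun t => l (g t) : R)).
Proof.
move=> lc gL1; apply: (le_integrable _ _ _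
  (L1_seminorm_integrable (norm_functional_seminorm lc) gL1)) => //.
  apply/measurable_EFinP; apply: borel_separable_measurable => //.
  apply: (borel_separable_comp (U := setT) (f := l)) => //; first exact: openT.
    by move=> x _; exact: lc.
  exact: L1_borel_separable gL1.
by move=> x _ /=; rewrite lee_fin normr_id.
Qed.

Lemma L1_sub (E : tvsType R) a b c d (g : R -> E) : metrizable R E ->
  a <= c -> d <= b -> L1 a b g -> L1 c d g.
Proof.
move=> mE ac db gL1.
have sub : `[c, d]%classic `<=` `[a, b]%classic.
  by apply: subset_itv; rewrite bnd_simp.
have [mg sg] := borel_separable_sub mE (measurable_itv _) sub (L1_borel_separable gL1).
split=> // q hq; have [_ _ /(_ q hq)] := gL1; apply: le_lt_trans.
have /integrableP[mq _] := L1_seminorm_integrable hq gL1.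
apply: ge0_subset_integral => // x _; rewrite lee_fin; exact: seminorm_ge0.
Qed.

(** Absolute continuity with its density exposed.  The weak integral is required
    between any two points, not only from the left endpoint, so that the notion
    visibly restricts to subsegments. *)
Definition primitive (E : tvsType R) a b (g eta : R -> E) : Prop :=
  L1 a b g /\ forall s t, a <= s -> s <= t -> t <= b ->
    weak_integral s t g (eta t - eta s).

Lemma AC_segmentP (E : tvsType R) a b (eta : R -> E) :
  AC_segment a b eta <-> exists g, primitive a b g eta.
Proof.
split=> [[g gL1 w]|[g [gL1 w]]]; exists g => //; last first.
  by move=> t /andP[at_ tb]; exact: w.
split=> // s t as_ st tb l lc.
have iab := L1_functional_integrable lc gL1.
have ws := w s _ l lc; have wt := w t _ l lc.
have -> : eta t - eta s = (eta t - eta a) - (eta s - eta a).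
  by rewrite opprB addrA subrK.
rewrite linearB/= wt ?(le_trans as_ st)// ws ?as_ ?(le_trans st tb)//.
have iat : mu.-integrable `[a, t]%classic (EFin \o (fun x => l (g x) : R)).
  by apply: integrableS iab => //; apply: subset_itv; rewrite bnd_simp.
by apply/eqP; rewrite subr_eq addrC; apply/eqP; exact: Rintegral_cat as_ st iat.
Qed.

Lemma primitive_sub (E : tvsType R) a b c d (g eta : R -> E) : metrizable R E ->
  a <= c -> d <= b -> primitive a b g eta -> primitive c d g eta.
Proof.
move=> mE ac db [gL1 w]; split; first exact: (L1_sub mE ac db).
by move=> s t cs st td; apply: w => //; [exact: le_trans cs|exact: le_trans db].
Qed.

(** Test the weak integral against a functional below [q] that attains [q] at the
    increment of [eta]. *)
Lemma primitive_seminorm (E : tvsType R) a b (g eta : R -> E) (q : E -> R) s t :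
  primitive a b g eta -> continuous_seminorm q -> a <= s -> s <= t -> t <= b ->
  q (eta t - eta s) <= \int[mu]_(x in `[s, t]%classic) q (g x).
Proof.
move=> [gL1 w] hq as_ st tb.
have [l [lc lq <-]] := seminorm_functional (eta t - eta s) hq.
rewrite (w s t as_ st tb l lc).
have sub : `[s, t]%classic `<=` `[a, b]%classic.
  by apply: subset_itv; rewrite bnd_simp.
apply: le_Rintegral => //.
- by apply: integrableS (L1_functional_integrable lc gL1).
- by apply: integrableS (L1_seminorm_integrable hq gL1).
- by move=> x _; exact: le_trans (ler_norm _) (lq _).
Qed.

Lemma L1_pair (E F : tvsType R) a b (f : R -> E) (g : R -> F) :
  metrizable R E -> metrizable R F -> L1 a b f -> L1 a b g ->
  L1 a b (fun t => (f t, g t)).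
Proof.
move=> mE mF fL1 gL1.
have [mfg sfg] := borel_separable_pair mE mF (measurable_itv _)
  (L1_borel_separable fL1) (L1_borel_separable gL1).
split=> // q hq.
have hq1 := comp_continuous_seminorm hq (@linear_pair0r _ E F)
  (@continuous_pair0r _ E F).
have hq2 := comp_continuous_seminorm hq (@linear_pair0l _ E F)
  (@continuous_pair0l _ E F).
have /integrableP[m1 i1] := L1_seminorm_integrable hq1 fL1.
have /integrableP[m2 i2] := L1_seminorm_integrable hq2 gL1.
have [_ _ /(_ _ hq1) l1] := fL1; have [_ _ /(_ _ hq2) l2] := gL1.
apply: le_lt_trans (lte_add_pinfty l1 l2).
rewrite -ge0_integralD//; last 2 first.
- by move=> x _; rewrite lee_fin (seminorm_ge0 hq1).
- by move=> x _; rewrite lee_fin (seminorm_ge0 hq2).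
apply: ge0_le_integral => //.
- by move=> x _; rewrite lee_fin (seminorm_ge0 hq).
- apply/measurable_EFinP; apply: borel_separable_measurable => //.
  apply: (borel_separable_comp (U := setT) (f := q)) => //; first exact: openT.
  by move=> x _; exact: (seminorm_continuous hq).
- exact: emeasurable_funD.
- move=> x _; rewrite -EFinD lee_fin.
  have := seminormD hq (f x, 0) (0, g x).
  by rewrite -[(f x, 0) + _]/(f x + 0, 0 + g x) addr0 add0r.
Qed.

Lemma primitive_pair (E F : tvsType R) a b (f eta : R -> E) (g zeta : R -> F) :
  metrizable R E -> metrizable R F -> primitive a b f eta -> primitive a b g zeta ->
  primitive a b (fun t => (f t, g t)) (fun t => (eta t, zeta t)).
Proof.
move=> mE mF [fL1 fw] [gL1 gw]; split; first exact: L1_pair.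
move=> s t as_ st tb l lc.
have l1l : linear (fun x : E => l (x, 0) : R^o).
  by move=> r x y; rewrite linear_pair0r linearP.
have l2l : linear (fun y : F => l (0, y) : R^o).
  by move=> r x y; rewrite linear_pair0l linearP.
pose lm1 := GRing.isLinear.Build R E R^o *:%R (fun x : E => l (x, 0)) l1l.
pose l1 : {linear E -> R^o} := HB.pack (fun x : E => l (x, 0) : R^o) lm1.
pose lm2 := GRing.isLinear.Build R F R^o *:%R (fun y : F => l (0, y)) l2l.
pose l2 : {linear F -> R^o} := HB.pack (fun y : F => l (0, y) : R^o) lm2.
have l1c : continuous l1.
  by move=> x; apply: continuous_comp; [exact: continuous_pair0r|exact: lc].
have l2c : continuous l2.
  by move=> x; apply: continuous_comp; [exact: continuous_pair0l|exact: lc].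
have split_l x y : l (x, y) = l1 x + l2 y.
  by rewrite /l1 /l2/= -linearD -[(x, 0) + _]/(x + 0, 0 + y) addr0 add0r.
rewrite -[_ - _]/(eta t - eta s, zeta t - zeta s) split_l.
rewrite (fw s t as_ st tb l1 l1c) (gw s t as_ st tb l2 l2c).
have sub : `[s, t]%classic `<=` `[a, b]%classic.
  by apply: subset_itv; rewrite bnd_simp.
rewrite -RintegralD//.
- by apply: eq_Rintegral => x _; rewrite split_l.
- exact: integrableS (L1_functional_integrable l1c fL1).
- exact: integrableS (L1_functional_integrable l2c gL1).
Qed.

End Integration.

(** * The chain rule for absolutely continuous curves *)

Section AbsolutelyContinuousChainRule.
Context {R : realType}.
Local Notation mu := (@lebesgue_measure R).
Implicit Types (a b s t u : R).

Lemma within_segment_near (T : topologicalType) a b (eta : R -> T) t (A : set T) :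
  {within `[a, b], continuous eta} -> a <= t <= b -> nbhs (eta t) A ->
  exists2 d, 0 < d &
    forall u, a <= u -> u <= b -> t - d < u -> u < t + d -> A (eta u).
Proof.
move=> /subspace_continuousP ec tab At.
have /ec/(_ _ At) : `[a, b]%classic t by rewrite /= in_itv.
rewrite /= /nbhs/= /within/= => -[d /= d0 dA]; exists d => // u au ub u1 u2.
apply: dA; last by rewrite /= in_itv/= au.
by rewrite /ball/= ltr_norml; lra.
Qed.

(** Measurability is that of [dir_deriv f \o (eta, g)].  Near each time,
    [dir_deriv f (eta t, -)] is bounded by one seminorm, which depends on [q] and
    on the time; compactness makes the integral finite on the whole segment. *)
Lemma L1_dir_deriv (E F : tvsType R) n (U : set E) (f : E -> F) a b
    (g eta : R -> E) :
  metrizable R E -> hausdorff_space F -> open U -> Cn n.+1 U f ->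
  {within `[a, b], continuous eta} -> (forall t, a <= t <= b -> U (eta t)) ->
  L1 a b g -> L1 a b (fun t => dir_deriv f (eta t, g t)).
Proof.
move=> mE hF oU fU ec etaU gL1.
have [mf sf] : borel_separable `[a, b]%classic (fun t => dir_deriv f (eta t, g t)).
  apply: (borel_separable_comp (U := U `*` [set: E]) (g := fun t => (eta t, g t))).
  - exact: measurable_itv.
  - by apply: openX => //; exact: openT.
  - by move=> [x y] [Ux _]; exact: (C1_dir_deriv_continuous fU).
  - by move=> t; rewrite /= in_itv/= => /etaU.
  - apply: borel_separable_pair => //; last exact: L1_borel_separable gL1.
    exact: borel_separable_continuous.
split=> // q hq.
have [ab|ba] := leP a b; last first.
  by rewrite set_itv_ge ?bnd_simp -?ltNge// integral_set0.
pose G t := q (dir_deriv f (eta t, g t)).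
have mG : measurable_fun `[a, b]%classic G.
  apply: borel_separable_measurable => //.
  apply: (borel_separable_comp (U := setT) (f := q)) => //; first exact: openT.
  by move=> x _; exact: (seminorm_continuous hq).
have mG' s t : a <= s -> t <= b -> measurable_fun `[s, t]%classic (EFin \o G).
  move=> as_ tb; apply/measurable_EFinP; apply: measurable_funS mG => //.
  by apply: subset_itv; rewrite bnd_simp.
have G0 x : (0 <= (G x)%:E)%E by rewrite lee_fin (seminorm_ge0 hq).
apply: (segment_principle
  (P := fun s u => (\int[mu]_(t in `[s, u]%classic) (G t)%:E < +oo)%E) ab).
  move=> s t u as_ st tu ub stG tuG.
  have -> : `[s, u]%classic = `[s, t]%classic `|` `]t, u]%classic.
    by rewrite -itv_bndbnd_setU ?bnd_simp.
  rewrite ge0_integral_setU//=; last 2 first.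
  - rewrite -itv_bndbnd_setU ?bnd_simp//; exact: mG'.
  - apply/disj_setPS => x [/=]; rewrite !in_itv/= => /andP[_ xt] /andP[tx _].
    by move: tx; rewrite ltNge xt.
  apply: lte_add_pinfty => //; apply: le_lt_trans tuG.
  apply: ge0_subset_integral => //; first by apply: mG' => //; exact: le_trans st.
  by apply: subset_itvr; rewrite bnd_simp.
move=> t tab; have [p hp pb] := C1_bound hF oU (etaU t tab) fU hq.
have [d d0 dp] := within_segment_near ec tab (seminorm_ball hp (eta t) ltr01).
exists d => // s u as_ ds su ud ub.
have [_ _ /(_ p hp)] := gL1; apply: le_lt_trans.
have /integrableP[mpg _] := L1_seminorm_integrable hp gL1.
have sub : `[s, u]%classic `<=` `[a, b]%classic.
  by apply: subset_itv; rewrite bnd_simp.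
apply: (@le_trans _ _ (\int[mu]_(t in `[s, u]%classic) (p (g t))%:E)%E).
  apply: ge0_le_integral => //.
  - exact: mG'.
  - by apply: measurable_funS mpg.
  - move=> x; rewrite /= in_itv/= => /andP[sx xu]; rewrite lee_fin.
    by have [|_ ] := pb (eta x); [apply: dp; lra|apply].
by apply: ge0_subset_integral => // x _; rewrite lee_fin (seminorm_ge0 hp).
Qed.

Lemma dir_deriv_functional (E F : tvsType R) n (U : set E) (f : E -> F) (x : E)
    (l : {linear F -> R^o}) :
  hausdorff_space F -> open U -> U x -> Cn n.+1 U f -> continuous l ->
  exists2 l' : {linear E -> R^o}, continuous l' &
    forall v, l' v = l (dir_deriv f (x, v)).
Proof.
move=> hF oU Ux fU lc.
have ll : linear (fun v => l (dir_deriv f (x, v)) : R^o).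
  move=> r v w; rewrite (dir_derivD _ _ hF oU Ux fU) dir_derivZ ?linearP//.
  exact: (C1_has_dir_deriv _ fU).
pose lm := GRing.isLinear.Build R E R^o *:%R (fun v => l (dir_deriv f (x, v))) ll.
pose l' : {linear E -> R^o} := HB.pack (fun v => l (dir_deriv f (x, v)) : R^o) lm.
exists l' => //.
move=> v /=; apply: (continuous_comp (f := fun v => dir_deriv f (x, v)));
  last exact: lc.
apply: (continuous_comp (f := fun v => (x, v))).
  by apply: (cvg_pair (G := nbhs x) (H := nbhs v)); [exact: cvg_cst|exact: cvg_id].
exact: (C1_dir_deriv_continuous fU Ux).
Qed.

(** On a short subsegment [[s, u]] the increment of [l \o f \o eta] is
    [l (df (eta s, -))] evaluated at [eta u - eta s], up to a small multiple of
    the integral of [p \o g], by the mean value theorem and the Lipschitz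
    estimate for [df]; being linear and continuous, this functional passes under
    the weak integral.  The errors add up over subdivisions. *)
Lemma primitive_comp (E F : tvsType R) n (U : set E) (f : E -> F) a b
    (g eta : R -> E) :
  metrizable R E -> hausdorff_space F -> open U -> Cn n.+2 U f ->
  {within `[a, b], continuous eta} -> (forall t, a <= t <= b -> U (eta t)) ->
  primitive a b g eta ->
  primitive a b (fun t => dir_deriv f (eta t, g t)) (f \o eta).
Proof.
move=> mE hF oU fU ec etaU pge; have [gL1 gw] := pge.
have dL1 := L1_dir_deriv mE hF oU fU ec etaU gL1.
split=> // s0 u0 as0 su0 ub0 l lc.
pose h t : R := l (dir_deriv f (eta t, g t)).
have hi : mu.-integrable `[a, b]%classic (EFin \o h).
  exact: L1_functional_integrable lc dL1.
have isub (k : R -> R) s u : mu.-integrable `[a, b]%classic (EFin \o k) ->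
    a <= s -> u <= b -> mu.-integrable `[s, u]%classic (EFin \o k).
  by move=> ki as_ ub; apply: integrableS ki => //; apply: subset_itv; rewrite bnd_simp.
pose k t : R := l (f (eta t)).
rewrite linearB/=; change (k u0 - k s0 = \int[mu]_(t in `[s0, u0]%classic) h t).
apply: (segment_principle
  (P := fun s u => k u - k s = \int[mu]_(t in `[s, u]%classic) h t) su0).
  move=> s t u s0s st tu uu0 kst ktu.
  rewrite (Rintegral_cat st tu); first by rewrite -kst -ktu; ring.
  by apply: isub => //; [exact: le_trans s0s|exact: le_trans ub0].
move=> t /andP[s0t tu0].
have tab : a <= t <= b by rewrite (le_trans as0)//= (le_trans tu0).
have [p [hp pU plip]] := C2_bound hF oU (etaU t tab) fU lc.
have pgi := L1_seminorm_integrable hp gL1.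
have [d d0 dp] := within_segment_near ec tab (seminorm_ball hp (eta t) ltr01).
exists d => // s1 u1 ss1 ds1 su1 ud1 uu1.
have as1 : a <= s1 by exact: le_trans ss1.
have ub1 : u1 <= b by exact: le_trans ub0.
have near_t x : s1 <= x <= u1 -> p (eta x - eta t) < 1.
  by move=> /andP[sx xu]; apply: dp; lra.
pose m s u := \int[mu]_(t in `[s, u]%classic) p (g t).
suff key e : 0 < e ->
    `|k u1 - k s1 - \int[mu]_(t in `[s1, u1]%classic) h t| <= e * m s1 u1.
  apply/eqP; rewrite -subr_eq0 -normr_le0; apply/unstable.ler_gtP => z z0.
  have m0 : 0 <= m s1 u1 by apply: Rintegral_ge0 => x _; exact: (seminorm_ge0 hp).
  have e0 : 0 < z / (m s1 u1 + 1) by rewrite divr_gt0//; lra.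
  apply: le_trans (key _ e0) _; rewrite mulrAC ler_pdivrMr ?ler_pM2l//; lra.
move=> e0; have e20 : 0 < e / 4 by lra.
apply: (segment_principle (P := fun s u =>
  `|k u - k s - \int[mu]_(t in `[s, u]%classic) h t| <= e * m s u) su1).
  move=> s x u s1s sx xu uu1' ksx kxu.
  have as_ : a <= s by exact: le_trans s1s.
  have ub : u <= b by exact: le_trans ub1.
  rewrite /m (Rintegral_cat sx xu (isub _ _ _ hi as_ ub)).
  rewrite (Rintegral_cat sx xu (isub _ _ _ pgi as_ ub)) mulrDr.
  apply: le_trans (lerD ksx kxu); apply: le_trans (ler_normD _ _).
  by rewrite le_eqVlt; apply/orP; left; apply/eqP; congr (`|_|); ring.
move=> x /andP[s1x xu1].
have xab : a <= x <= b by rewrite (le_trans as1)//= (le_trans xu1).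
have [d' d'0 d'p] := within_segment_near ec xab (seminorm_ball hp (eta x) e20).
exists d' => // s u s1s ds su ud uu1'.
have as_ : a <= s by exact: le_trans s1s.
have ub : u <= b by exact: le_trans ub1.
have close y : s <= y -> y <= u -> p (eta s - eta y) <= e / 2.
  move=> sy yu; have -> : eta s - eta y = (eta s - eta x) - (eta y - eta x).
    by rewrite opprB addrA subrK.
  apply: le_trans (seminormD hp _ _) _; rewrite (seminormN hp).
  have : p (eta s - eta x) < e / 4 by apply: d'p; lra.
  have : p (eta y - eta x) < e / 4 by apply: d'p; lra.
  lra.
have ps : p (eta s - eta t) < 1 by apply: near_t; lra.
have pu : p (eta u - eta t) < 1 by apply: near_t; lra.
have [l' l'c l'E] := dir_deriv_functional hF oU (pU _ ps) fU lc.
pose D := eta u - eta s.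
have Dm : p D <= m s u by exact: primitive_seminorm pge hp as_ su ub.
have De : p D <= e / 2 by rewrite /D (seminormBC hp); exact: close.
have seg (r : R) : 0 <= r <= 1 -> p (eta s + r *: D - eta t) < 1.
  by move=> r01; apply: (seminorm_ball_convex hp r01 ps); rewrite /D subrKC.
have est1 : `|k u - k s - l' D| <= e / 2 * m s u.
  have [|r r01] := mean_value (x := eta s) (y := D) lc fU.
    by move=> r /seg/pU.
  rewrite {1}/D subrKC /k => ->; rewrite l'E.
  apply: le_trans (plip _ _ ps (seg r r01) D) _.
  rewrite addrC addKr (seminormZ hp).
  have r1 : `|r| * p D <= e / 2.
    have /andP[r0 r1] := r01; rewrite ger0_norm//; apply: le_trans De.
    by rewrite ler_piMl// (seminorm_ge0 hp).
  apply: le_trans (ler_wpM2r (seminorm_ge0 hp D) r1) _.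
  by rewrite ler_pM2l//; lra.
(* Freezing the base point at [eta s] makes the integrand linear in [g]. *)
have l'i : mu.-integrable `[s, u]%classic (EFin \o (fun y => l' (g y) : R)).
  by apply: isub => //; exact: L1_functional_integrable l'c gL1.
have his := isub _ _ _ hi as_ ub.
have pgis := isub _ _ _ pgi as_ ub.
have est2 : `|l' D - \int[mu]_(t in `[s, u]%classic) h t| <= e / 2 * m s u.
  have -> : l' D = \int[mu]_(y in `[s, u]%classic) (l' (g y) : R).
    exact: (gw s u as_ su ub l' l'c).
  rewrite -RintegralB//.
  have di : mu.-integrable `[s, u]%classic (EFin \o (fun y => (l' (g y) : R) - h y)).
    exact: (@integrableB _ _ _ mu _ (measurable_itv _) _ _ l'i his).
  apply: le_trans (@le_normr_Rintegral _ _ _ mu _ _ (measurable_itv _) di) _.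
  rewrite /m -RintegralZl//; apply: le_Rintegral => //.
  - exact: (integrable_norm (mu := mu) di).
  - exact: (@integrableZl _ _ _ mu _ (measurable_itv _) (e / 2) _ pgis).
  - move=> y /=; rewrite in_itv/= => /andP[sy yu].
    rewrite l'E /h; apply: le_trans (plip _ _ _ ps (g y)) _.
      by apply: near_t; lra.
    by apply: ler_wpM2r; [exact: (seminorm_ge0 hp)|exact: close].
have -> : k u - k s - \int[mu]_(t in `[s, u]%classic) h t =
    (k u - k s - l' D) + (l' D - \int[mu]_(t in `[s, u]%classic) h t) by ring.
apply: le_trans (ler_normD _ _) _; lra.
Qed.

End AbsolutelyContinuousChainRule.

(** * Curves with vanishing derivative *)

Section VanishingDerivative.
Context {R : realType}.
Local Notation mu := (@lebesgue_measure R).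

Lemma has_deriv_interior (E : tvsType R) (I : set R) (g : R -> E) (t : R) (w : E) :
  nbhs t I -> has_deriv I g t w ->
  (fun h : R => h^-1 *: (g (t + h) - g t)) @ (0 : R)^' --> w.
Proof.
move=> tI gw A /gw; rewrite /= /within/=.
have tI0 : \forall h \near (0 : R)^', I (t + h).
  exact: cvg_near (@cvg_shift _ t) tI.
by move=> h; apply: filterS2 tI0 h => x /= Ix; apply.
Qed.

Lemma has_deriv_subset (E : tvsType R) (I K : set R) (g : R -> E) (t : R) (w : E) :
  K `<=` I -> has_deriv I g t w -> has_deriv K g t w.
Proof.
move=> KI gw; apply: cvg_trans gw; apply: cvg_app.
by apply: within_subset => h; exact: KI.
Qed.

(** For each functional [l], the derivative of [l \o w] is [l \o g] at almost
    every time, so that [l \o g] vanishes almost everywhere. *)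
Lemma primitive_deriv0 (E : tvsType R) (a b : R) (g w : R -> E) :
  hausdorff_space E -> a <= b -> primitive a b g w ->
  {ae mu, forall t, a < t < b -> has_deriv `[a, b]%classic w t 0} -> w a = w b.
Proof.
move=> hE ab [gL1 gw] w0; apply: functional_separates => // l lc.
pose f t : R := l (g t).
have fi : mu.-integrable `[a, b]%classic (EFin \o f).
  exact: L1_functional_integrable lc gL1.
have fw s t : a <= s -> s <= t -> t <= b ->
    l (w t) - l (w s) = \int[mu]_(x in `[s, t]%classic) f x.
  by move=> as_ st tb; rewrite -linearB; exact: gw.
pose fab := f \_ `[a, b]%classic.
have lfab : locally_integrable [set: R] fab by exact: integrable_locally.
have fabi (y : R) : mu.-integrable [set` Interval (BLeft a) (BRight y)] (EFin \o fab).
  have : mu.-integrable setT (EFin \o fab).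
    rewrite -restrict_EFin; apply/integrable_restrict => //.
    by rewrite setTI.
  by apply: (@integrableS _ _ _ mu setT) => //; exact: measurable_itv.
have f0 : {ae mu, forall t, a < t < b -> f t = 0}.
  pose F (x : R) := \int[mu]_(t in [set` Interval (BLeft a) (BRight x)]) fab t.
  have Fw t : a <= t <= b -> F t = l (w t) - l (w a).
    move=> /andP[at_ tb]; rewrite fw// /F; apply: eq_Rintegral => x.
    rewrite inE/= in_itv/= => /andP[ax xt]; rewrite /fab patchE mem_set//=.
    by rewrite in_itv/= ax (le_trans xt).
  move: w0 (FTC1 fabi lfab); apply: filterS2; first exact: (ae_filter_ringOfSetsType mu).
  move=> t w0 Ft /andP[at_ tb].
  have tab : nbhs t `[a, b]%classic.
    apply: filterS (near_in_itvoo _) => [x|].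
      by rewrite /=; exact: subset_itv_oo_cc.
    by rewrite in_itv/= at_.
  have [_] := Ft at_; rewrite -/F.
  have -> : fab t = f t.
    by rewrite /fab patchE mem_set//= in_itv/= !ltW.
  move=> <-; apply: cvg_lim; first exact: Rhausdorff.
  have wt : (fun h : R => h^-1 *: (w (t + h) - w t)) @ (0 : R)^' --> (0 : E).
    by apply: has_deriv_interior tab (w0 _); rewrite at_.
  have {}wt : (fun h : R => l (h^-1 *: (w (t + h) - w t))) @ (0 : R)^' --> l 0.
    by apply: (cvg_comp _ l wt); exact: lc.
  rewrite linear0 in wt; apply: (cvg_eqF _ wt).
  have := cvg_near (@cvg_shift _ t) tab; apply: filterS => h; rewrite /= in_itv/= => thab.
  rewrite [h + t]addrC !Fw ?(ltW at_) ?(ltW tb)//.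
  rewrite linearZ/= linearB; congr (_ *: _); ring.
apply/eqP; rewrite eq_sym -subr_eq0 fw//.
have io : mu.-integrable `]a, b]%classic (EFin \o f).
  by apply: integrableS fi => //; apply: subset_itvr; rewrite bnd_simp.
have ioo : mu.-integrable `]a, b[%classic (EFin \o f).
  by apply: integrableS io => //; apply: subset_itvl; rewrite bnd_simp.
rewrite -Rintegral_itv_obnd_cbnd// -Rintegral_itv_bndo_bndc//.
rewrite /Rintegral (ae_eq_integral (cst 0%E)) ?integral0//.
  by case/integrableP: ioo.
move: f0; apply: filterS; first exact: (ae_filter_ringOfSetsType mu).
by move=> t f0; rewrite /= in_itv/= => /f0 ->.
Qed.

End VanishingDerivative.

(** * Smooth maps between manifolds *)

Section SmoothMaps.
Context {R : realType}.

Definition smooth (E F : tvsType R) (M N : topologicalType)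
    (A : set (chart E M)) (B : set (chart F N)) (f : M -> N) : Prop :=
  Ck_map Cinfty A B [set: M] f.

(** Smoothness of the identity says that the charts are compatible; in this
    form it passes to products by pairing the projections. *)
Definition smooth_atlas (E : tvsType R) (M : topologicalType)
    (A : set (chart E M)) : Prop :=
  [/\ hausdorff_space E, forall x, exists2 c, A c & chart_dom c x & smooth A A id].

Lemma chart_image_open (E : tvsType R) (M : topologicalType) (c : chart E M)
    (V : set M) : open V -> open (c @` (chart_dom c `&` V)).
Proof.
move=> oV; rewrite openE => _ [x [cx Vx] <-].
have yc : nbhs (c x) (c @` chart_dom c).
  by apply: open_nbhs_nbhs; split; [exact: chart_cod_open|exists x].
have yV : nbhs (c x) (chart_inv c @^-1` V).
  apply: (chart_inv_cont (imageP c cx)); rewrite chart_mapK//.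
  exact: open_nbhs_nbhs.
apply: filterS2 yc yV => _ [x' cx' <-] /=; rewrite chart_mapK// => Vx'.
by exists x'.
Qed.

Lemma open_preimage (M N : topologicalType) (f : M -> N) (V : set N) :
  continuous f -> open V -> open (f @^-1` V).
Proof. by move=> /continuousP; apply. Qed.

Lemma smooth_continuous (E F : tvsType R) (M N : topologicalType)
    (A : set (chart E M)) (B : set (chart F N)) (f : M -> N) :
  smooth A B f -> continuous f.
Proof. by move=> [fc _] x; exact: fc. Qed.

Lemma smooth_chart n (E F : tvsType R) (M N : topologicalType)
    (A : set (chart E M)) (B : set (chart F N)) (f : M -> N) c d :
  smooth A B f -> A c -> B d ->
  Cn n (c @` (chart_dom c `&` f @^-1` chart_dom d)) (d \o f \o chart_inv c).
Proof. by move=> [_ fs] Ac Bd; have := fs c d Ac Bd n; rewrite setIT. Qed.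

Lemma chart_dom_preimage_open (E F : tvsType R) (M N : topologicalType)
    (c : chart E M) (d : chart F N) (f : M -> N) :
  continuous f -> open (c @` (chart_dom c `&` f @^-1` chart_dom d)).
Proof.
by move=> fc; apply/chart_image_open/open_preimage => //; exact: chart_dom_open.
Qed.

Lemma smooth_comp (E F G : tvsType R) (M N P : topologicalType)
    (A : set (chart E M)) (B : set (chart F N)) (C : set (chart G P))
    (f : M -> N) (g : N -> P) :
  smooth_atlas A -> smooth_atlas B -> smooth_atlas C ->
  smooth A B f -> smooth B C g -> smooth A C (g \o f).
Proof.
move=> [hE _ _] [hF covB _] [hG _ _] fs gs.
have fc := smooth_continuous fs; have gc := smooth_continuous gs.
have gfc : continuous (g \o f).
  by move=> x; apply: continuous_comp; [exact: fc|exact: gc].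
split=> [x _|c e Ac Ce n]; first exact: gfc.
rewrite setIT; apply: Cn_local => _ [x [cx ex] <-].
have [d Bd dx] := covB (f x).
pose V := c @` (chart_dom c `&` (f @^-1` chart_dom d `&` (g \o f) @^-1` chart_dom e)).
have oV : open V.
  apply/chart_image_open/openI; apply: open_preimage => //; exact: chart_dom_open.
exists V, ((e \o g \o chart_inv d) \o (d \o f \o chart_inv c)); split=> //.
- by exists x.
- apply: (Cn_comp (V := d @` (chart_dom d `&` g @^-1` chart_dom e))) => //.
  + exact: chart_dom_preimage_open.
  + exact: smooth_chart gs Bd Ce.
  + apply: (Cn_subset (chart_dom_preimage_open c d fc) _ _ (smooth_chart n fs Ac Bd)) => //.
    by move=> _ [y [cy [dy _]] <-]; exists y.
  + move=> _ [y [cy [dy ey]] <-] /=; exists (f y) => //.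
    by rewrite chart_mapK.
- move=> _ /set_mem[y [cy [dy ey]] <-] /=.
  by rewrite (chart_mapK cy) (chart_mapK dy).
Qed.

Lemma smooth_pair (E F G : tvsType R) (M N P : topologicalType)
    (A : set (chart E M)) (B : set (chart F N)) (C : set (chart G P))
    (f : M -> N) (g : M -> P) :
  smooth_atlas B -> smooth_atlas C ->
  smooth A B f -> smooth A C g -> smooth A (prod_atlas B C) (fun x => (f x, g x)).
Proof.
move=> [hF _ _] [hG _ _] fs gs.
have fc := smooth_continuous fs; have gc := smooth_continuous gs.
have fgc : continuous (fun x => (f x, g x)).
  by move=> x; apply: (cvg_pair (G := nbhs _) (H := nbhs _)); [exact: fc|exact: gc].
split=> [x _|c _ Ac [d Bd [e Ce <-]] n]; first exact: fgc.
rewrite setIT.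
have oV := chart_dom_preimage_open c (prod_chart d e) fgc.
apply: (Cn_pair (f := d \o f \o chart_inv c) (g := e \o g \o chart_inv c)) => //.
- apply: (Cn_subset (chart_dom_preimage_open c d fc) _ _ (smooth_chart n fs Ac Bd)) => //.
  by move=> _ [y [cy [dy _]] <-]; exists y.
- apply: (Cn_subset (chart_dom_preimage_open c e gc) _ _ (smooth_chart n gs Ac Ce)) => //.
  by move=> _ [y [cy [_ ey]] <-]; exists y.
Qed.

Lemma smooth_cst (E F : tvsType R) (M N : topologicalType)
    (A : set (chart E M)) (B : set (chart F N)) (y : N) :
  smooth_atlas B -> smooth A B (cst y).
Proof.
move=> [hF _ _]; split=> [x _|c d Ac Bd n]; first exact: cvg_cst.
exact: (@Cn_cst _ n E F _ (d y)).
Qed.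

Lemma smooth_fst (E F : tvsType R) (M N : topologicalType)
    (A : set (chart E M)) (B : set (chart F N)) :
  smooth_atlas A -> smooth_atlas B -> smooth (prod_atlas A B) A fst.
Proof.
move=> [hE _ idA] [hF _ _]; split=> [x _|_ e [c Ac [d Bd <-]] Ae n].
  exact: cvg_fst.
rewrite setIT; have hEF := hausdorff_prod hE hF.
have fc : continuous (@fst M N) by move=> p; exact: cvg_fst.
have oV := chart_dom_preimage_open (prod_chart c d) e fc.
apply: (Cn_comp (V := c @` (chart_dom c `&` id @^-1` chart_dom e))
  (f := e \o id \o chart_inv c) (g := fst)) => //.
- by apply: chart_dom_preimage_open => x; exact: cvg_id.
- exact: smooth_chart idA Ac Ae.
- exact: Cn_fst.
- by move=> _ [[x y] [[/= cx dy] ex] <-]; exists x.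
Qed.

Lemma smooth_snd (E F : tvsType R) (M N : topologicalType)
    (A : set (chart E M)) (B : set (chart F N)) :
  smooth_atlas A -> smooth_atlas B -> smooth (prod_atlas A B) B snd.
Proof.
move=> [hE _ _] [hF _ idB]; split=> [x _|_ e [c Ac [d Bd <-]] Be n].
  exact: cvg_snd.
rewrite setIT; have hEF := hausdorff_prod hE hF.
have sc : continuous (@snd M N) by move=> p; exact: cvg_snd.
have oV := chart_dom_preimage_open (prod_chart c d) e sc.
apply: (Cn_comp (V := d @` (chart_dom d `&` id @^-1` chart_dom e))
  (f := e \o id \o chart_inv d) (g := snd)) => //.
- by apply: chart_dom_preimage_open => x; exact: cvg_id.
- exact: smooth_chart idB Bd Be.
- exact: Cn_snd.
- by move=> _ [[x y] [[/= cx dy] ey] <-]; exists y.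
Qed.

Lemma smooth_prod_atlas (E F : tvsType R) (M N : topologicalType)
    (A : set (chart E M)) (B : set (chart F N)) :
  smooth_atlas A -> smooth_atlas B -> smooth_atlas (prod_atlas A B).
Proof.
move=> sA sB; have [hE covA _] := sA; have [hF covB _] := sB; split.
- exact: hausdorff_prod.
- move=> [x y]; have [c Ac cx] := covA x; have [d Bd dy] := covB y.
  by exists (prod_chart c d) => //; exists c => //; exists d.
- have := smooth_pair sA sB (smooth_fst sA sB) (smooth_snd sA sB).
  by rewrite (_ : (fun p : M * N => (p.1, p.2)) = id)//; apply/funext => -[].
Qed.

Lemma manifold_smooth_atlas (E : tvsType R) (M : topologicalType)
    (S : manifold Cinfty E M) : smooth_atlas S.
Proof.
split; first exact: (model_hausdorff S).
- move=> x; exists (chart_at S x); first exact: chart_at_atlas.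
  exact: chart_at_dom.
- split=> [x _|c d Sc Sd]; first exact: cvg_id.
  by rewrite setIT; have [] := atlas_compatible Sc Sd.
Qed.

(** The differential of [f] at [x], in the coordinates given by [c] and [d]. *)
Definition chart_deriv (E F : tvsType R) (M N : topologicalType)
    (c : chart E M) (d : chart F N) (f : M -> N) (x : M) (v : E) : F :=
  dir_deriv (d \o f \o chart_inv c) (c x, v).

Lemma chart_deriv_comp (E F G : tvsType R) (M N P : topologicalType)
    (A : set (chart E M)) (B : set (chart F N)) (C : set (chart G P))
    (f : M -> N) (g : N -> P) c d e x v :
  smooth_atlas C -> smooth A B f -> smooth B C g -> A c -> B d -> C e ->
  chart_dom c x -> chart_dom d (f x) -> chart_dom e (g (f x)) ->
  chart_deriv c e (g \o f) x v =
  chart_deriv d e g (f x) (chart_deriv c d f x v).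
Proof.
move=> [hG _ _] fs gs Ac Bd Ce cx dx ex.
have fc := smooth_continuous fs; have gc := smooth_continuous gs.
have oU := chart_dom_preimage_open c d fc.
have Ucx : (c @` (chart_dom c `&` f @^-1` chart_dom d)) (c x) by exists x.
rewrite /chart_deriv.
rewrite (@dir_deriv_local _ _ _ _ _ ((e \o g \o chart_inv d) \o (d \o f \o chart_inv c))
  _ _ oU Ucx); last first.
  move=> _ /set_mem[y [cy dy] <-] /=.
  by rewrite (chart_mapK cy) (chart_mapK dy).
have dE : (d \o f \o chart_inv c) (c x) = d (f x) by rewrite /= chart_mapK.
rewrite (dir_deriv_comp hG (chart_dom_preimage_open d e gc) _
  (smooth_chart 1 gs Bd Ce)).
- by congr (dir_deriv _ (_, _)); exact: dE.
- by exists (f x).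
- by apply: (C1_has_dir_deriv _ (smooth_chart 1 fs Ac Bd)); exists x.
Qed.

Lemma chart_deriv_pair (E F G : tvsType R) (M N P : topologicalType)
    (A : set (chart E M)) (B : set (chart F N)) (C : set (chart G P))
    (f : M -> N) (g : M -> P) c d e x v :
  smooth_atlas B -> smooth_atlas C -> smooth A B f -> smooth A C g ->
  A c -> B d -> C e -> chart_dom c x -> chart_dom d (f x) -> chart_dom e (g x) ->
  chart_deriv c (prod_chart d e) (fun x => (f x, g x)) x v =
  (chart_deriv c d f x v, chart_deriv c e g x v).
Proof.
move=> [hF _ _] [hG _ _] fs gs Ac Bd Ce cx dx ex.
apply: (dir_deriv_pair (f := d \o f \o chart_inv c) (g := e \o g \o chart_inv c)) => //.
  by apply: (C1_has_dir_deriv _ (smooth_chart 1 fs Ac Bd)); exists x.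
by apply: (C1_has_dir_deriv _ (smooth_chart 1 gs Ac Ce)); exists x.
Qed.

Lemma chart_deriv_cst (E F : tvsType R) (M N : topologicalType)
    (c : chart E M) (d : chart F N) (y : N) x v :
  hausdorff_space F -> chart_deriv c d (cst y) x v = 0.
Proof.
move=> hF; apply: dir_derivE => //.
rewrite (_ : diff_quot _ _ _ = cst 0); first exact: cvg_cst.
by apply/funext => h; rewrite /diff_quot/= subrr scaler0.
Qed.

Lemma chart_deriv0 (E F : tvsType R) (M N : topologicalType)
    (c : chart E M) (d : chart F N) (f : M -> N) x :
  hausdorff_space F -> chart_deriv c d f x 0 = 0.
Proof.
move=> hF; apply: dir_derivE => //.
rewrite (_ : diff_quot _ _ _ = cst 0); first exact: cvg_cst.
by apply/funext => h; rewrite /diff_quot/= scaler0 addr0 subrr scaler0.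
Qed.

End SmoothMaps.

(** * Absolutely continuous curves in manifolds *)

Section CurvesInManifolds.
Context {R : realType}.
Local Notation mu := (@lebesgue_measure R).

(** One-sided when [t0] is an endpoint of [I]. *)
Lemma small_segment (I : set R) (t0 : R) (A : set R) :
  nondegenerate_interval I -> I t0 -> nbhs t0 A ->
  exists al be, [/\ al < be, al <= t0 <= be, `[al, be]%classic `<=` I `&` A &
    within I (nbhs t0) `[al, be]%classic].
Proof.
move=> [iI [x0 [y0 [Ix0 Iy0 xy0]]]] It0 [d /= d0 dA].
have d20 : 0 < d / 2 by lra.
have [al [Ial al1 al2 alI] aleq] : exists2 al, [/\ I al, al <= t0, t0 - d / 2 <= al &
    \forall z \near t0, I z -> al <= z] & al = t0 -> forall z, I z -> t0 <= z.
  have [[x [Ix xt]]|nx] := pselect (exists x, I x /\ x < t0); last first.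
    have le z : I z -> t0 <= z.
      by move=> Iz; rewrite leNgt; apply/negP => zt; apply: nx; exists z.
    by exists t0 => //; split=> //; [lra|near=> z; exact: le].
  have mt : Num.max x (t0 - d / 2) < t0 by rewrite gt_max xt; lra.
  exists (Num.max x (t0 - d / 2)); last by move=> e; move: mt; rewrite e ltxx.
  split.
  - by apply: (iI x t0) => //; rewrite le_max lexx (ltW mt).
  - exact: ltW.
  - by rewrite le_max lexx orbT.
  - by near=> z => _; apply: ltW; near: z; exact: lt_nbhsr.
have [be [Ibe be1 be2 beI] beeq] : exists2 be, [/\ I be, t0 <= be, be <= t0 + d / 2 &
    \forall z \near t0, I z -> z <= be] & be = t0 -> forall z, I z -> z <= t0.
  have [[x [Ix xt]]|nx] := pselect (exists x, I x /\ t0 < x); last first.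
    have le z : I z -> z <= t0.
      by move=> Iz; rewrite leNgt; apply/negP => zt; apply: nx; exists z.
    by exists t0 => //; split=> //; [lra|near=> z; exact: le].
  have mt : t0 < Num.min x (t0 + d / 2) by rewrite lt_min xt; lra.
  exists (Num.min x (t0 + d / 2)); last by move=> e; move: mt; rewrite e ltxx.
  split.
  - by apply: (iI t0 x) => //; rewrite ge_min lexx (ltW mt).
  - exact: ltW.
  - by rewrite ge_min lexx orbT.
  - by near=> z => _; apply: ltW; near: z; exact: lt_nbhsl.
exists al, be; split.
- rewrite lt_neqAle (le_trans al1 be1) andbT; apply/eqP => ab.
  have alt : al = t0 by apply/le_anti; rewrite al1 ab be1.
  have bet : be = t0 by rewrite -ab.
  have := aleq alt _ Ix0; have := beeq bet _ Iy0; lra.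
- by rewrite al1.
- move=> x; rewrite /= in_itv/= => /andP[ax xb]; split.
    by apply: (iI al be) => //; rewrite ax.
  by apply: dA; rewrite /= ltr_norml; lra.
- apply: filterS2 alI beI => z alz zbe Iz.
  by rewrite /= in_itv/= alz ?zbe.
Unshelve. all: by end_near. Qed.

Lemma AC_segment_eq (E : tvsType R) (a b : R) (f g : R -> E) :
  (forall t, a <= t <= b -> f t = g t) -> a <= b ->
  AC_segment a b f -> AC_segment a b g.
Proof.
move=> fg ab [h hL1 hw]; exists h => // t tab.
by rewrite -!fg ?lexx//; exact: hw.
Qed.

(** The localisation through which all constructions on absolutely continuous
    curves pass: [A0] matches the segments of two curves, and [B] keeps the curve
    in the preimage of a chart domain under a map out of [N]. *)
Lemma AC_local (E : tvsType R) (N : topologicalType) (A : set (chart E N))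
    (I K : set R) (eta : R -> N) (t0 : R) (A0 : set R) (B : set N) :
  metrizable R E -> Defs.AC A I eta -> K `<=` I -> nondegenerate_interval K -> K t0 ->
  nbhs t0 A0 -> nbhs (eta t0) B ->
  exists al be, exists2 c : chart E N, A c & exists g : R -> E,
    [/\ al < be, `[al, be]%classic `<=` K `&` A0,
        within K (nbhs t0) `[al, be]%classic,
        forall t, al <= t <= be -> chart_dom c (eta t) /\ B (eta t) &
        primitive al be g (c \o eta)].
Proof.
move=> mE [etac etaAC] KI ndK Kt0 tA0 tB.
have It0 := KI _ Kt0.
have [al0 [be0 [ab0 abI abt [c [Ac cab /AC_segmentP[g pg]]]]]] := etaAC t0 It0.
have tB' : nbhs t0 [set t | I t -> B (eta t)].
  by move/subspace_continuousP: etac => /(_ _ It0 _ tB).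
have tab : nbhs t0 [set t | I t -> `[al0, be0]%classic t] by exact: abt.
have [al [be [ab albe abK abn]]] :=
  small_segment ndK Kt0 (filterI tA0 (filterI tB' tab)).
have sub t : al <= t <= be -> K t /\ (A0 t /\ B (eta t) /\ al0 <= t <= be0).
  move=> tab1; have [|Kt [A0t [Bt abt1]]] := abK t; first by rewrite /= in_itv.
  have It := KI _ Kt; split=> //; split=> //; split; first exact: Bt.
  by have := abt1 It; rewrite /= in_itv.
have [|_ [_ [_ /andP[al0al _]]]] := sub al; first by rewrite lexx ltW.
have [|_ [_ [_ /andP[_ bebe0]]]] := sub be; first by rewrite lexx ltW.
exists al, be, c => //; exists g; split=> //.
- by move=> t /=; rewrite in_itv/= => /sub[? []].
- move=> t /sub[Kt [_ [Bt tab1]]]; split=> //.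
  by apply: cab; exists t.
- exact: primitive_sub pg.
Qed.

Lemma AC_sub (E : tvsType R) (N : topologicalType) (A : set (chart E N))
    (I K : set R) (eta : R -> N) :
  metrizable R E -> Defs.AC A I eta -> K `<=` I -> nondegenerate_interval K ->
  Defs.AC A K eta.
Proof.
move=> mE etaAC KI ndK; split; first exact: continuous_subspaceW etaAC.1.
move=> t0 Kt0; have [al [be [c Ac [g [ab abK abn cab pg]]]]] :=
  AC_local mE etaAC KI ndK Kt0 (@filterT _ (nbhs t0) _) (@filterT _ (nbhs (eta t0)) _).
exists al, be; split=> //; first by move=> t /abK[].
exists c; split=> //; last by apply/AC_segmentP; exists g.
by move=> _ [t tab <-]; move: tab; rewrite /= in_itv/= => /cab[].
Qed.

Lemma AC_smooth_comp (E F : tvsType R) (M N : topologicalType)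
    (A : set (chart E M)) (B : set (chart F N)) (f : M -> N) (I : set R)
    (eta : R -> M) :
  metrizable R E -> smooth_atlas B -> nondegenerate_interval I ->
  smooth A B f -> Defs.AC A I eta -> Defs.AC B I (f \o eta).
Proof.
move=> mE [hF covB _] ndI fs etaAC; have fc := smooth_continuous fs.
split.
  have /subspace_continuousP ec := etaAC.1; apply/subspace_continuousP => t It.
  by apply: (cvg_comp eta f (ec t It)); exact: fc.
move=> t0 It0; have [d Bd dt0] := covB (f (eta t0)).
have tB : nbhs (eta t0) (f @^-1` chart_dom d).
  by apply: fc; apply: open_nbhs_nbhs; split=> //; exact: chart_dom_open.
have [al [be [c Ac [g [ab abI abn cab pg]]]]] :=
  AC_local mE etaAC (@subset_refl _ I) ndI It0 (@filterT _ (nbhs t0) _) tB.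
exists al, be; split=> //; first by move=> t /abI[].
exists d; split=> //.
  by move=> _ [t tab <-]; move: tab; rewrite /= in_itv/= => /cab[].
have oU := chart_dom_preimage_open c d fc.
have cc : {within `[al, be], continuous (c \o eta)}.
  apply/subspace_continuousP => t tab.
  have : {within `[al, be], continuous eta}.
    by apply: continuous_subspaceW etaAC.1 => x /abI[].
  move=> /subspace_continuousP/(_ t tab) etat.
  apply: (cvg_comp eta c etat); apply: chart_map_cont.
  by move: tab; rewrite /= in_itv/= => /cab[].
have pf := primitive_comp mE hF oU (smooth_chart 2 fs Ac Bd) cc _ pg.
apply: (@AC_segment_eq _ _ _ ((d \o f \o chart_inv c) \o (c \o eta))) (ltW ab) _.
  by move=> t /cab[ct _] /=; rewrite chart_mapK.
apply/AC_segmentP; eexists; apply: pf => t /cab[ct dt].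
by exists (eta t).
Qed.

Lemma AC_pair (E F : tvsType R) (M N : topologicalType)
    (A : set (chart E M)) (B : set (chart F N)) (I : set R)
    (eta : R -> M) (zeta : R -> N) :
  metrizable R E -> metrizable R F -> nondegenerate_interval I ->
  Defs.AC A I eta -> Defs.AC B I zeta ->
  Defs.AC (prod_atlas A B) I (fun t => (eta t, zeta t)).
Proof.
move=> mE mF ndI etaAC zetaAC; split.
  have /subspace_continuousP ec := etaAC.1; have /subspace_continuousP zc := zetaAC.1.
  apply/subspace_continuousP => t It.
  by apply: (cvg_pair (G := nbhs _) (H := nbhs _)); [exact: ec|exact: zc].
move=> t0 It0.
have [al0 [be0 [c Ac [g [ab0 abI0 abn0 cab0 pg]]]]] :=
  AC_local mE etaAC (@subset_refl _ I) ndI It0 (@filterT _ (nbhs t0) _)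
    (@filterT _ (nbhs (eta t0)) _).
have [al [be [d Bd [h [ab abI abn dab ph]]]]] :=
  AC_local mF zetaAC (@subset_refl _ I) ndI It0 abn0 (@filterT _ (nbhs (zeta t0)) _).
have sub t : al <= t <= be -> al0 <= t <= be0.
  move=> tab; have [|It /(_ It)] := abI t; first by rewrite /= in_itv.
  by rewrite /= in_itv.
have /andP[al0al _] : al0 <= al <= be0 by apply: sub; rewrite lexx ltW.
have /andP[_ bebe0] : al0 <= be <= be0 by apply: sub; rewrite lexx ltW.
exists al, be; split=> //; first by move=> t /abI[].
exists (prod_chart c d); split; first by exists c => //; exists d.
  move=> _ [t tab <-]; move: tab; rewrite /= in_itv/= => tab.
  by split; [have [] := cab0 t (sub t tab)|have [] := dab t tab].
apply/AC_segmentP; exists (fun t => (g t, h t)).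
apply: (primitive_pair (eta := c \o eta) (zeta := d \o zeta) mE mF) => //.
exact: primitive_sub pg.
Qed.

End CurvesInManifolds.

(** * Velocities *)

Section Velocities.
Context {R : realType}.
Local Notation mu := (@lebesgue_measure R).

Lemma within_shift_near (T : topologicalType) (I : set R) (eta : R -> T) (t : R)
    (B : set T) : {within I, continuous eta} -> I t -> nbhs (eta t) B ->
  \forall h \near within [set h | I (t + h)] (0 : R)^', B (eta (t + h)).
Proof.
move=> /subspace_continuousP ec It tB.
have tI : nbhs t [set x | I x -> B (eta x)] by exact: (ec t It _ tB).
exact: cvg_near (@cvg_shift _ t) tI.
Qed.

Lemma has_deriv_near (E : tvsType R) (I : set R) (f g : R -> E) (t : R) (w : E) :
  (\forall h \near within [set h | I (t + h)] (0 : R)^', f (t + h) = g (t + h)) ->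
  f t = g t -> has_deriv I f t w -> has_deriv I g t w.
Proof.
move=> fg fgt fw; rewrite /has_deriv -fgt; apply: (cvg_eqF _ fw).
by apply: filterS fg => h ->.
Qed.

Lemma chart_has_deriv (E F : tvsType R) (M N : topologicalType)
    (A : set (chart E M)) (B : set (chart F N)) (f : M -> N) c d (I : set R)
    (eta : R -> M) (t : R) (v : E) :
  smooth_atlas B -> smooth A B f -> A c -> B d -> {within I, continuous eta} ->
  I t -> chart_dom c (eta t) -> chart_dom d (f (eta t)) ->
  has_deriv I (c \o eta) t v ->
  has_deriv I (d \o f \o eta) t (chart_deriv c d f (eta t) v).
Proof.
move=> [hF _ _] fs Ac Bd ec It ct dt cv.
have oU := chart_dom_preimage_open c d (smooth_continuous fs).
have Ut : (c @` (chart_dom c `&` f @^-1` chart_dom d)) ((c \o eta) t).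
  by exists (eta t).
have := has_deriv_comp hF oU Ut (smooth_chart 1 fs Ac Bd) cv.
apply: has_deriv_near; last by rewrite /= chart_mapK.
have tc : nbhs (eta t) (chart_dom c).
  by apply: open_nbhs_nbhs; split=> //; exact: chart_dom_open.
by apply: filterS (within_shift_near ec It tc) => h ch; rewrite /= chart_mapK.
Qed.

Lemma chart_deriv_id (E : tvsType R) (N : topologicalType) (c : chart E N) x v :
  hausdorff_space E -> chart_dom c x -> chart_deriv c c id x v = v.
Proof.
move=> hE cx; rewrite /chart_deriv.
have cod : (c @` chart_dom c) (c x) by exists x.
rewrite (@dir_deriv_local _ _ _ _ _ id _ _ (chart_cod_open c) cod); last first.
  by move=> _ /set_mem[y cy <-]; rewrite /= chart_mapK.
apply: dir_derivE => //; apply: (cvg_eqF _ (cvg_cst v)).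
near=> h; rewrite /diff_quot addrAC subrr add0r scalerA mulVf ?scale1r//.
by near: h; exact: near_neq0.
Unshelve. all: by end_near. Qed.

(** By the chain rule, the unspecified chart of a velocity may be replaced by the
    chart that coordinatises the tangent space. *)
Lemma has_velocityE (E : tvsType R) (N : topologicalType)
    (S : manifold Cinfty E N) (I : set R) (eta : R -> N) (t : R)
    (v : tangent S (eta t)) :
  {within I, continuous eta} -> I t ->
  has_velocity I v <-> has_deriv I (chart_at S (eta t) \o eta) t v.
Proof.
move=> ec It; have sS := manifold_smooth_atlas S; have [hE _ idS] := sS; split.
  move=> [c [w [Sc ct cw ->]]].
  exact: (chart_has_deriv sS idS Sc (chart_at_atlas S _) ec It ct (chart_at_dom S _) cw).
move=> tv; exists (chart_at S (eta t)), v; split=> //.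
- exact: chart_at_atlas.
- exact: chart_at_dom.
- by rewrite -[LHS](chart_deriv_id _ hE (chart_at_dom S (eta t))).
Qed.

(** In any chart the derivative is the image of zero under a differential, so
    the vector-valued statement applies on each short segment. *)
Lemma AC_velocity0_const (E : tvsType R) (N : topologicalType)
    (S : manifold Cinfty E N) (I : set R) (w : R -> N) :
  metrizable R E -> nondegenerate_interval I -> Defs.AC S I w ->
  {ae mu, forall t, I t -> has_deriv I (chart_at S (w t) \o w) t 0} ->
  forall s t, I s -> I t -> w s = w t.
Proof.
move=> mE ndI wAC w0.
suff le s t : s <= t -> I s -> I t -> w s = w t.
  by move=> s t Is It; case: (leP s t) => [/le|/ltW/le ->]; [apply|by []|by []|by []].
move=> st Is It; have [iI _] := ndI.
apply: (segment_principle (P := fun x y => w x = w y) st).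
  by move=> x y z _ _ _ _ ->.
move=> r /andP[sr rt]; have Ir : I r by apply: (iI s t) => //; rewrite sr.
have [al [be [c Sc [g [ab abI abn cab pg]]]]] :=
  AC_local mE wAC (@subset_refl _ I) ndI Ir (@filterT _ (nbhs r) _)
    (@filterT _ (nbhs (w r)) _).
have [d /= d0 dI] : nbhs r [set x | I x -> `[al, be]%classic x] by exact: abn.
exists d => // x y sx dx xy yd yt.
have Ix z : x <= z <= y -> I z.
  move=> /andP[xz zy]; apply: (iI s t) => //.
  by rewrite (le_trans sx xz) (le_trans zy yt).
have abxy z : x <= z <= y -> al <= z <= be.
  move=> xzy; have := dI z; rewrite /= in_itv/=; apply; last exact: Ix.
  by rewrite ltr_norml; move/andP: xzy => [? ?]; lra.
have xx : x <= x <= y by rewrite lexx.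
have yy : x <= y <= y by rewrite lexx xy.
have sS := manifold_smooth_atlas S; have [hE _ idS] := sS.
have pxy : primitive x y g (c \o w).
  by apply: primitive_sub pg => //; [have /andP[] := abxy x xx|have /andP[] := abxy y yy].
have cx := (cab x (abxy x xx)).1; have cy := (cab y (abxy y yy)).1.
rewrite -(chart_mapK cx) -(chart_mapK cy); congr (chart_inv c _).
apply: (primitive_deriv0 hE xy pxy).
move: w0; apply: filterS; first exact: (ae_filter_ringOfSetsType mu).
move=> z wz /andP[xz zy]; have xzy : x <= z <= y by rewrite !ltW.
have Iz := Ix z xzy; have cz := (cab z (abxy z xzy)).1.
have := chart_has_deriv sS idS (chart_at_atlas S (w z)) Sc wAC.1 Iz
  (chart_at_dom S (w z)) cz (wz Iz).
rewrite chart_deriv0//; apply: has_deriv_subset => u; rewrite /= in_itv/=.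
exact: Ix.
Qed.

End Velocities.

(** * Orbit curves of a Lie group action *)

Section LieGroupActions.
Context {R : realType}.
Local Notation mu := (@lebesgue_measure R).
Variables (E F : tvsType R) (G : groupTopologicalType) (M : topologicalType).
Variables (SG : manifold Cinfty E G) (SM : manifold Cinfty F M).
Hypothesis hG : lie_group SG.
Variable sigma : M * G -> M.
Hypothesis sigma_smooth : smooth (prod_atlas SM SG) SM sigma.
Hypothesis sigma_action : right_action sigma.

Let sSG : smooth_atlas SG := manifold_smooth_atlas SG.
Let sSM : smooth_atlas SM := manifold_smooth_atlas SM.

Lemma smooth_mulg (P : topologicalType) (H : tvsType R) (A : set (chart H P))
    (f g : P -> G) : smooth_atlas A -> smooth A SG f -> smooth A SG g ->
  smooth A SG (fun x => (f x * g x)%g).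
Proof.
move=> sA fs gs; have [mul_smooth _] := hG.
have := smooth_comp sA (smooth_prod_atlas sSG sSG) sSG (smooth_pair sSG sSG fs gs)
  mul_smooth.
by [].
Qed.

Lemma smooth_invg (P : topologicalType) (H : tvsType R) (A : set (chart H P))
    (f : P -> G) : smooth_atlas A -> smooth A SG f ->
  smooth A SG (fun x => (f x)^-1%g).
Proof.
move=> sA fs; have [_ inv_smooth] := hG.
exact: (smooth_comp sA sSG sSG fs inv_smooth).
Qed.

Lemma smooth_action (P : topologicalType) (H : tvsType R) (A : set (chart H P))
    (f : P -> M) (g : P -> G) : smooth_atlas A -> smooth A SM f -> smooth A SG g ->
  smooth A SM (fun x => sigma (f x, g x)).
Proof.
move=> sA fs gs.
exact: (smooth_comp sA (smooth_prod_atlas sSM sSG) sSM (smooth_pair sSM sSG fs gs)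
  sigma_smooth).
Qed.

Lemma left_translateE (g : G) (v : tangent SG 1%g) :
  left_translate g v =
  chart_deriv (chart_at SG 1%g) (chart_at SG g) (fun h => (g * h)%g) 1%g v.
Proof. by rewrite /left_translate /tangent_map mulg1. Qed.

Lemma fundamentalE (v : tangent SG 1%g) (y : M) :
  fundamental SM sigma v y =
  chart_deriv (chart_at SG 1%g) (chart_at SM y) (fun h => sigma (y, h)) 1%g v.
Proof. by rewrite /fundamental /tangent_map sigma_action.1. Qed.

Lemma smooth_orbit (y : M) : smooth SG SM (fun h => sigma (y, h)).
Proof.
apply: smooth_action => //; first exact: smooth_cst.
by case: sSG.
Qed.

Lemma smooth_left_translation (g : G) : smooth SG SG (fun h => (g * h)%g).
Proof.
apply: smooth_mulg => //; first exact: smooth_cst.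
by case: sSG.
Qed.

Variables (a b : R) (gamma : R -> tangent SG 1%g) (eta : R -> G).
Hypothesis mE : metrizable R E.
Hypothesis mF : metrizable R F.
Hypothesis hab : a < b.
Hypothesis heta : evolution a b gamma eta.

Let J := `[a, b]%classic.
Let f := fun t (y : M) => fundamental SM sigma (gamma t) y.
Let W := J `*` [set: M].

Lemma segment_nondegenerate : nondegenerate_interval J.
Proof.
split; first exact: interval_is_interval.
by exists a, b; split=> //; rewrite /J/= in_itv/= lexx ltW.
Qed.

Definition action_flow (t t0 : R) (y0 : M) : M :=
  sigma (y0, ((eta t0)^-1 * eta t)%g).

Lemma action_flow_comp t0 t1 t2 y0 :
  action_flow t2 t1 (action_flow t1 t0 y0) = action_flow t2 t0 y0.
Proof. by rewrite /action_flow sigma_action.2 mulgA mulgK. Qed.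

Lemma action_flow_id t y0 : action_flow t t y0 = y0.
Proof. by rewrite /action_flow mulVg sigma_action.1. Qed.

Lemma action_flow_AC t0 y0 : Defs.AC SM J (fun t => action_flow t t0 y0).
Proof.
have [etaAC _ _] := heta.
apply: (AC_smooth_comp (f := fun h => sigma (y0, ((eta t0)^-1 * h)%g)) mE sSM
  segment_nondegenerate _ etaAC).
apply: smooth_action => //; first exact: smooth_cst.
exact: smooth_left_translation.
Qed.

(** At a time where [eta' = eta.gamma], translating by [(eta t)^-1] turns the
    flow into the orbit map of the current point. *)
Lemma action_flow_velocity t t0 y0 : J t ->
  has_velocity J (left_translate (eta t) (gamma t)) ->
  has_velocity (eta := fun t => action_flow t t0 y0) J (f t (action_flow t t0 y0)).
Proof.
move=> Jt; have [[etac _] _ _] := heta.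
move=> /(has_velocityE _ etac Jt) ev.
apply/(has_velocityE _ (action_flow_AC t0 y0).1 Jt).
pose k h := sigma (y0, ((eta t0)^-1 * h)%g).
have ks : smooth SG SM k.
  apply: smooth_action => //; first exact: smooth_cst.
  exact: smooth_left_translation.
have := chart_has_deriv sSM ks (chart_at_atlas SG (eta t))
  (chart_at_atlas SM (action_flow t t0 y0)) etac Jt (chart_at_dom SG _)
  (chart_at_dom SM _) ev.
rewrite left_translateE /f fundamentalE.
have -> : (fun h => sigma (action_flow t t0 y0, h)) = k \o (fun h => (eta t * h)%g).
  by apply/funext => h; rewrite /k /action_flow/= sigma_action.2 mulgA.
rewrite (chart_deriv_comp (A := SG) (B := SG) (C := SM) (d := chart_at SG (eta t))
  _ sSM (smooth_left_translation (eta t)) ks) ?mulg1//.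
- exact: chart_at_atlas.
- exact: chart_at_atlas.
- exact: chart_at_atlas.
- exact: chart_at_dom.
- exact: chart_at_dom.
- exact: chart_at_dom.
Qed.

Lemma action_flow_solution t0 y0 : J t0 ->
  ivp_solution W f t0 y0 J (fun t => action_flow t t0 y0).
Proof.
move=> Jt0; have [_ _ etav] := heta.
split=> //; last exact: action_flow_id.
split; first exact: segment_nondegenerate.
- exact: action_flow_AC.
- by move=> t Jt; split.
- move: etav; apply: filterS; first exact: (ae_filter_ringOfSetsType mu).
  by move=> t etav Jt; apply: action_flow_velocity => //; exact: etav.
Qed.

(** For a solution [zeta], the curve [sigma (zeta t, (eta t)^-1)] has velocity
    zero: this velocity is the derivative at [1] of the constant map
    [h |-> sigma (sigma (zeta t, h), (eta t * h)^-1)] in the direction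
    [gamma t]. *)
Lemma solution_action_flow (I : set R) (zeta : R -> M) : solution W f I zeta ->
  forall s t, I s -> I t -> zeta t = action_flow t s (zeta s).
Proof.
move=> [ndI zAC IW zv] s t Is It; have [etaAC _ etav] := heta.
have IJ : I `<=` J by move=> x /IW[].
have eAC := AC_sub mE etaAC IJ ndI.
pose m (p : M * G) := sigma (p.1, p.2^-1%g).
have sP := smooth_prod_atlas sSM sSG.
have ms : smooth (prod_atlas SM SG) SM m.
  apply: smooth_action => //; first exact: smooth_fst.
  by apply: smooth_invg => //; exact: smooth_snd.
pose w x := m (zeta x, eta x).
have zeAC := AC_pair mF mE ndI zAC eAC.
have wAC : Defs.AC SM I w.
  exact: (AC_smooth_comp (metrizable_prod mF mE) sSM ndI ms zeAC).
have ww : w s = w t.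
  apply: (AC_velocity0_const mF ndI wAC) => //.
  move: zv etav; apply: filterS2; first exact: (ae_filter_ringOfSetsType mu).
  move=> x zv etav Ix; have Jx := IJ _ Ix.
  have {zv} /(has_velocityE _ zAC.1 Ix) zv := zv Ix.
  have {etav} /(has_velocityE _ etaAC.1 Jx) ev := etav Jx.
  have {}ev := has_deriv_subset IJ ev.
  pose c := prod_chart (chart_at SM (zeta x)) (chart_at SG (eta x)).
  have cA : prod_atlas SM SG c.
    by exists (chart_at SM (zeta x)); [exact: chart_at_atlas|
      exists (chart_at SG (eta x)) => //; exact: chart_at_atlas].
  have cx : chart_dom c (zeta x, eta x) by split; exact: chart_at_dom.
  have zev : has_deriv I (c \o (fun t => (zeta t, eta t))) x
      (f x (zeta x), left_translate (eta x) (gamma x)).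
    by apply: (cvg_pair (G := nbhs _) (H := nbhs _)); [exact: zv|exact: ev].
  have := chart_has_deriv sSM ms cA (chart_at_atlas SM (w x)) zeAC.1 Ix cx
    (chart_at_dom SM _) zev.
  rewrite left_translateE /f fundamentalE.
  have os := smooth_orbit (zeta x); have ls := smooth_left_translation (eta x).
  rewrite -(chart_deriv_pair (A := SG) (B := SM) (C := SG) _ sSM sSG os ls);
    [|exact: chart_at_atlas|exact: chart_at_atlas|exact: chart_at_atlas
     |exact: chart_at_dom|by rewrite sigma_action.1; exact: chart_at_dom
     |by rewrite mulg1; exact: chart_at_dom].
  pose P (h : G) := (sigma (zeta x, h), (eta x * h)%g).
  have P1 : P 1%g = (zeta x, eta x) by rewrite /P sigma_action.1 mulg1.
  have Ps : smooth SG (prod_atlas SM SG) P by exact: smooth_pair.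
  have mP : m \o P = cst (w x).
    apply/funext => h; rewrite /m /P /w /m/= sigma_action.2.
    by rewrite invgM mulgA mulgV mul1g.
  rewrite -[X in chart_deriv _ _ m X]P1.
  rewrite -(chart_deriv_comp (f := P) (A := SG) (B := prod_atlas SM SG) (C := SM)
    _ sSM Ps ms);
    [|exact: chart_at_atlas|exact: cA|exact: chart_at_atlas
     |exact: chart_at_dom|by rewrite P1|by rewrite P1; exact: chart_at_dom].
  by rewrite mP chart_deriv_cst//; case: sSM.
have := congr1 (fun y => sigma (y, eta t)) ww.
rewrite /w /m/= !sigma_action.2 mulVg sigma_action.1 => <-.
by rewrite /action_flow.
Qed.

End LieGroupActions.

(** * Solutions of the action equation *)

Theorem theorem1p2 (R : realType) (E F : tvsType R)
    (G : groupTopologicalType) (M : topologicalType)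
    (SG : manifold Cinfty E G) (SM : manifold Cinfty F M)
    (hE : frechet E) (hF : frechet F) (hG : lie_group SG)
    (sigma : M * G -> M)
    (sigma_smooth :
      Ck_map Cinfty (prod_atlas SM SG) SM [set: M * G] sigma)
    (sigma_action : right_action sigma)
    (a b : R) (hab : a < b)
    (gamma : R -> tangent SG 1%g) (hgamma : L1 a b gamma)
    (eta : R -> G) (heta : evolution a b gamma eta) :
  let J := `[a, b]%classic in
  let W := J `*` [set: M] in
  let f := fun t (y : M) => fundamental SM sigma (gamma t) y in
  [/\ local_existence J W f,
      local_uniqueness W f,
      maximal_flow W f (J `*` J `*` [set: M])
        (fun p => sigma (p.2, ((eta p.1.2)^-1 * eta p.1.1)%g)) &
      local_flows_pullback J W f Cinfty].
Proof.
move=> J W f; have [mE _] := hE; have [mF _] := hF.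
have sSG := manifold_smooth_atlas SG; have sSM := manifold_smooth_atlas SM.
have flow_sol t0 y0 : J t0 ->
    ivp_solution W f t0 y0 J (fun t => action_flow sigma eta t t0 y0).
  by move=> Jt0; exact: (action_flow_solution hG).
have sol_flow I zeta : solution W f I zeta -> forall s t, I s -> I t ->
    zeta t = action_flow sigma eta t s (zeta s).
  exact: (solution_action_flow hG sigma_smooth sigma_action mE mF heta).
have Jopen : relatively_open J J by exists setT; [exact: openT|rewrite setIT].
split.
- move=> t0 y0 [/= Jt0 _]; exists J, (fun t => action_flow sigma eta t t0 y0).
  by split=> //; exact: flow_sol.
- move=> I1 I2 z1 z2 s1 s2 t0 I1t0 I2t0 z12.
  have [[i1 _] _ _ _] := s1; have [[i2 _] _ _ _] := s2.
  exists (I1 `&` I2); split=> //.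
  + move=> x y [x1 x2] [y1 y2] z xzy.
    by split; [exact: (i1 x y)|exact: (i2 x y)].
  + by exists setT; [exact: openT|rewrite setIT].
  + move=> t [It1 It2].
    by rewrite (sol_flow _ _ s1 t0 t)// (sol_flow _ _ s2 t0 t)// z12.
- split=> [t t0 y0 [[_ /= Jt0] _]|t0 y0 [/= Jt0 _]]; first by split.
  have -> : [set t | (J `*` J `*` [set: M]) (t, t0, y0)] = J.
    by apply/seteqP; split=> [t [[]]|t Jt].
  split; first exact: flow_sol.
  move=> I zeta [sz It0 zt0] t It; have [_ _ zW _] := sz.
  split; first by split=> //; split=> //=; case: (zW t It).
  by rewrite (sol_flow _ _ sz t0 t)// zt0.
- move=> tbar ybar [/= Jt _].
  exists J, setT, (action_flow sigma eta); split.
    by split=> //; exact: interval_is_interval.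
  split; first by split=> //; exact: openT.
  split; first by move=> t0 y0 Jt0 _; exact: flow_sol.
  split.
    exists setT; split=> //; first exact: openT.
    by move=> t0 t1 t2 y0 _ _ _ _; apply: action_flow_comp.
  have [etaAC _ etav] := heta.
  split.
    exists E, E, G, G, SG, SG, eta, eta,
      (fun p => sigma (p.2, (p.1.2^-1 * p.1.1)%g)); split=> //.
    split=> //; rewrite setXTT.
    have s2 := smooth_prod_atlas sSG sSG; have s3 := smooth_prod_atlas s2 sSM.
    have fs := smooth_fst s2 sSM.
    apply: (smooth_action sigma_smooth s3); first exact: smooth_snd.
    apply: (smooth_mulg hG s3).
      apply: (smooth_invg hG s3).
      exact: (smooth_comp s3 s2 sSG fs (smooth_snd sSG sSG)).
    exact: (smooth_comp s3 s2 sSG fs (smooth_fst sSG sSG)).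
  have [N [mN N0 NP]] := etav.
  exists (J `\` N); split.
  + by apply: measurableD => //; exact: measurable_itv.
  + by move=> t [].
  + rewrite setDD; apply: (subset_measure0 _ _ _ N0) => //.
    by apply: measurableI => //; exact: measurable_itv.
  + move=> y0 t0 t _ _ [Jtt nN]; apply: (action_flow_velocity hG) => //.
    by apply: contrapT => nv; apply: nN; apply: NP => /(_ Jtt).
Qed.
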